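(* Let $k\ge1$. A general Poisson structure $\sigma\in H^0(Z_k,\Lambda^2\mathcal T_{Z_k})$ is given in canonical coordinates by $\big(\sigma_U\,\tfrac{\partial}{\partial z}\wedge\tfrac{\partial}{\partial u},\ \sigma_V\,\tfrac{\partial}{\partial\xi}\wedge\tfrac{\partial}{\partial v}\big)$, where $(\sigma_U,\sigma_V)$ is of the form (1) $(f_U+z\,g_U,\ -\xi f_V-g_V)$ for $k=1$; (2) $(f_U,\ -f_V)$ for $k=2$; (3) $(u\,f_U+zu\,g_U+z^2u\,h_U,\ -\xi^2v\,f_V-\xi v\,g_V-v\,h_V)$ for $k\ge3$; for any global functions $(f_U,f_V),(g_U,g_V),(h_U,h_V)\in H^0(Z_k,\mathcal O_{Z_k})$. Thus, in the basis $\big(\tfrac{\partial}{\partial z}\wedge\tfrac{\partial}{\partial u},\tfrac{\partial}{\partial\xi}\wedge\tfrac{\partial}{\partial v}\big)$, the space $H^0(Z_k,\Lambda^2\mathcal T_{Z_k})$ of Poisson structures is generated, as a module over global functions, by (1) $(1,-\xi),\ (z,-1)$ for $k=1$; (2) $(1,-1)$ for $k=2$; (3) $(u,-\xi^2v),\ (zu,-\xi v),\ (z^2u,-v)$ for $k\ge3$.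
   Context: $Z_k=\mathrm{Tot}(\mathcal O_{\mathbb P^1}(-k))$ is the surface covered by the canonical charts $U=\mathbb C^2_{(z,u)}$ and $V=\mathbb C^2_{(\xi,v)}$, glued on $U\cap V=\mathbb C^*\times\mathbb C$ by $(\xi,v)=(z^{-1},z^ku)$. For a global function $f\in H^0(Z_k,\mathcal O_{Z_k})$, $f_U$ and $f_V$ denote its restrictions to $U$ and $V$ written in the coordinates $(z,u)$, resp. $(\xi,v)$. A (holomorphic) Poisson structure on $Z_k$ is a bivector field $\sigma\in H^0(Z_k,\Lambda^2\mathcal T_{Z_k})$ (the condition $[\sigma,\sigma]=0$ is automatic on a surface). It is recorded by the pair of coefficient functions $(\sigma_U,\sigma_V)$, which satisfy $\sigma_V=-z^{k-2}\sigma_U$ on $U\cap V$. *)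

(* Defs.v *)
From Stdlib Require Import Reals List.
From Coquelicot Require Import Coquelicot.

Open Scope C_scope.

(* Complex Frechet differentiability at every point of C^2: the differential is
   C-linear because both sides are normed modules over [C_AbsRing]. *)
Definition entire2 (f : C * C -> C) : Prop :=
  forall p : C * C,
    @ex_filterdiff C_AbsRing
      (prod_NormedModule C_AbsRing C_NormedModule C_NormedModule)
      C_NormedModule f (locally p).

(* Transition map of Z_k on z <> 0: (xi, v) = (z^-1, z^k u). *)
Definition glue (k : nat) (p : C * C) : C * C :=
  let (z, u) := p in (/ z, z ^ k * u).

(* A pair of functions, one on the chart U = C^2 in the coordinates (z, u), one
   on the chart V = C^2 in the coordinates (xi, v).  It records either a function
   on Z_k or a bivector field, through its coefficients with respect to
   d/dz /\ d/du and d/dxi /\ d/dv; only the compatibility on the overlap differs. *)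
Record chart_pair : Type := ChartPair {
  onU : C * C -> C;
  onV : C * C -> C
}.

Definition global_function (k : nat) (f : chart_pair) : Prop :=
  entire2 (onU f) /\ entire2 (onV f) /\
  forall z u : C, z <> 0 -> onV f (glue k (z, u)) = onU f (z, u).

(* Elements of H^0(Z_k, Lambda^2 T).  The factor - z^(k-2) is the Jacobian
   determinant of [glue k]; it is written - z^k / z^2 so that k < 2 is covered.
   The integrability condition [sigma, sigma] = 0 is void, since a surface
   carries no nonzero trivector. *)
Definition poisson_structure (k : nat) (sigma : chart_pair) : Prop :=
  entire2 (onU sigma) /\ entire2 (onV sigma) /\
  forall z u : C, z <> 0 ->
    onV sigma (glue k (z, u)) = - (z ^ k / z ^ 2) * onU sigma (z, u).

Definition czero : chart_pair := ChartPair (fun _ => 0) (fun _ => 0).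

Definition cadd (s t : chart_pair) : chart_pair :=
  ChartPair (fun p => onU s p + onU t p) (fun p => onV s p + onV t p).

Definition cmul (f s : chart_pair) : chart_pair :=
  ChartPair (fun p => onU f p * onU s p) (fun p => onV f p * onV s p).

Record is_submodule (k : nat) (M : chart_pair -> Prop) : Prop := {
  submodule_zero : M czero;
  submodule_add : forall s t, M s -> M t -> M (cadd s t);
  submodule_mul : forall f s, global_function k f -> M s -> M (cmul f s)
}.

(* The H^0(Z_k, O)-submodule generated by a list: the smallest one containing it. *)
Definition span (k : nat) (gens : list chart_pair) (s : chart_pair) : Prop :=
  forall M : chart_pair -> Prop,
    is_submodule k M -> (forall e, In e gens -> M e) -> M s.

Definition generated_by (k : nat) (gens : list chart_pair)
    (S : chart_pair -> Prop) : Prop :=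
  forall s : chart_pair, S s <-> span k gens s.

(* Main.v *)
Require Import Defs.
From Stdlib Require Import Reals List Lra Lia FunctionalExtensionality ClassicalEpsilon.
From Coquelicot Require Import Coquelicot.
Open Scope C_scope.

(* If [U(z, u) = z^m V(1/z, z^k u)] on the overlap, then [V(0, v)] is the V-part of a global
   function [g] with U-part [V(0, z^k u)], and subtracting [z^m g_U] and [g_V] leaves
   [V - g_V = xi V'], a pair of the same type with [m - 1] in place of [m].  A Poisson
   structure is such a pair, up to sign, with [m = 2 - k] for [k <= 2]; for [k >= 3] its
   coefficients vanish on [u = 0] by a Liouville argument, and dividing by the fibre
   coordinate leaves [m = 2].

   The analytic input is that an entire function vanishing on [xi = 0] is [xi] times an
   entire function.  Only pointwise differentiability is assumed, so it goes back to
   Goursat's theorem: in the coordinate [c + exp(s + i t)] it shows that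
   [int (phi(c + r e^it) - phi(c)) / (r e^it) dt = 2 pi phi'(c)] for every [r].  This
   bounds the partial derivatives, makes them Lipschitz, and, by differentiation under
   the integral sign, entire; the division follows from a Taylor expansion. *)

(** * Differentiability in the plane and in [C^2] *)

Notation "⟦ x ⟧" := (Cmod x%C) (at level 0, x at level 99, format "⟦ x ⟧") : R_scope.

(** Lowering [m] to [0] splits off [m] global functions and leaves one more, which is why there are
    two generators for k = 1, one for k = 2 and three for k >= 3. For k >= 3 the exponent 2 - k is
    negative and the peeling cannot start. Division by the fibre coordinate repairs this: since v =
    z^k u, the relation z^(k-2) u tau_U = z^k u tau_V becomes tau_U = z^2 tau_V, whatever k is.
    Splitting off the restriction to xi = 0 does the work of sorting the monomials of a double power
    series, without any question of convergence. The integral formula is only ever used at the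
    centre of a circle. Applied to the difference of two translates of f it controls increments of a
    partial derivative, so regularity of that derivative need not be known beforehand. *)

Definition cder (f : C -> C) (z d : C) : Prop :=
  forall eps : R, (0 < eps)%R -> exists delta : R, (0 < delta)%R /\
    forall h : C, (Cmod h < delta)%R ->
      (⟦f (z + h) - f z - d * h⟧ <= eps * Cmod h)%R.

(** The sum of moduli stands in for the Euclidean norm of the product, which it bounds from both
    sides up to a factor 2; estimates then stay linear. *)
Definition cder2 (f : C * C -> C) (p : C * C) (a b : C) : Prop :=
  forall eps : R, (0 < eps)%R -> exists delta : R, (0 < delta)%R /\
    forall h k : C, (Cmod h < delta)%R -> (Cmod k < delta)%R ->
      (⟦f (fst p + h, snd p + k) - f p - (a * h + b * k)⟧
        <= eps * (Cmod h + Cmod k))%R.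

Lemma Cplus_minus (x y : C) : x + (y - x) = y.
Proof. ring. Qed.

Definition norm2 (h k : C) : R :=
  @norm _ (prod_NormedModule C_AbsRing C_NormedModule C_NormedModule) (h, k).

Lemma prod_norm_le (h k : C) :
  (norm2 h k
    <= Cmod h + Cmod k)%R.
Proof.
  change (sqrt (Cmod h ^ 2 + Cmod k ^ 2) <= Cmod h + Cmod k)%R.
  pose proof (Cmod_ge_0 h); pose proof (Cmod_ge_0 k).
  rewrite <- (sqrt_pow2 (Cmod h + Cmod k)) by lra.
  apply sqrt_le_1_alt; nra.
Qed.

Lemma le_prod_norm (h k : C) :
  (Cmod h <= norm2 h k /\
   Cmod k <= norm2 h k)%R.
Proof.
  change (Cmod h <= sqrt (Cmod h ^ 2 + Cmod k ^ 2) /\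
          Cmod k <= sqrt (Cmod h ^ 2 + Cmod k ^ 2))%R.
  pose proof (Cmod_ge_0 h); pose proof (Cmod_ge_0 k).
  split; [rewrite <- (sqrt_pow2 (Cmod h)) at 1 by lra
         |rewrite <- (sqrt_pow2 (Cmod k)) at 1 by lra];
  apply sqrt_le_1_alt; nra.
Qed.

Lemma cder_filterdiff (f : C -> C) (z d : C) :
  cder f z d ->
  @filterdiff C_AbsRing C_NormedModule C_NormedModule f (locally z) (fun h => d * h).
Proof.
  intros H; split.
  - split.
    + intros x y; apply Cmult_plus_distr_l.
    + intros k x; refine ((_ : @eq C (d * (k * x)) (k * (d * x)))); ring.
    + exists (Cmod d + 1)%R; split; [pose proof (Cmod_ge_0 d); lra|].
      intros x; change (⟦d * x⟧ <= (Cmod d + 1) * Cmod x)%R.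
      rewrite Cmod_mult; pose proof (Cmod_ge_0 x); nra.
  - intros x Hx.
    apply (is_filter_lim_locally_unique (V := C_NormedModule)) in Hx; subst x.
    intros eps.
    destruct (H eps (cond_pos eps)) as [delta [Hd Hf]].
    apply (locally_le_locally_norm (V := C_NormedModule)).
    exists (mkposreal _ Hd); intros y Hy.
    change (⟦y - z⟧ < delta)%R in Hy.
    change (⟦f y - f z - d * (y - z)⟧ <= eps * ⟦y - z⟧)%R.
    specialize (Hf (y - z) Hy).
    rewrite Cplus_minus in Hf; exact Hf.
Qed.

Lemma filterdiff_cder2 (f : C * C -> C) (p : C * C)  :
  @ex_filterdiff C_AbsRing
      (prod_NormedModule C_AbsRing C_NormedModule C_NormedModule)
      C_NormedModule f (locally p) -> exists a b, cder2 f p a b.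
Proof.
  intros [l [Hl H]].
  exists (l (RtoC 1, RtoC 0)), (l (RtoC 0, RtoC 1)).
  (* The differential is only given as an abstract C-linear map; its values on the two basis vectors
     are the partial derivatives. *)
  assert (El : forall h k : C, l (h, k) = l (RtoC 1, RtoC 0) * h + l (RtoC 0, RtoC 1) * k).
  { intros h k.
    pose proof (linear_scal l Hl h (RtoC 1, RtoC 0)
      : @eq C (l (h * 1, h * 0)) (h * l (RtoC 1, RtoC 0))) as E1.
    pose proof (linear_scal l Hl k (RtoC 0, RtoC 1)
      : @eq C (l (k * 0, k * 1)) (k * l (RtoC 0, RtoC 1))) as E2.
    pose proof (linear_plus l Hl (h * 1, h * 0) (k * 0, k * 1)
      : @eq C (l (h * 1 + k * 0, h * 0 + k * 1)) (l (h * 1, h * 0) + l (k * 0, k * 1))) as E3.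
    rewrite E1, E2 in E3.
    replace (h * 1 + k * 0) with h in E3 by ring.
    replace (h * 0 + k * 1) with k in E3 by ring.
    rewrite E3, (Cmult_comm h), (Cmult_comm k); reflexivity. }
  intros eps Heps.
  assert (Hp : is_filter_lim (locally p) p) by (intros P HP; exact HP).
  specialize (H p Hp (mkposreal _ Heps)).
  apply (locally_norm_le_locally
    (V := prod_NormedModule C_AbsRing C_NormedModule C_NormedModule)) in H.
  destruct H as [delta H].
  (* The ball is Euclidean, and its radius has to exceed |h| + |k|. *)
  exists (delta / 2)%R; split; [pose proof (cond_pos delta); lra|].
  intros h k Hh Hk.
  specialize (H (fst p + h, snd p + k)).
  destruct p as [z w]; simpl fst in *; simpl snd in *.
  assert (E : @minus (prod_AbelianGroup C_AbelianGroup C_AbelianGroup) (z + h, w + k)%C (z, w) = (h, k)).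
  { change ((z + h - z, w + k - w) = (h, k)); f_equal; ring. }
  assert (B : @ball_norm C_AbsRing (prod_NormedModule C_AbsRing C_NormedModule C_NormedModule) (z, w) delta (z + h, w + k)).
  { unfold ball_norm.
    change (@norm _ (prod_NormedModule C_AbsRing C_NormedModule C_NormedModule)
      (@minus (prod_AbelianGroup C_AbelianGroup C_AbelianGroup) (z + h, w + k)%C (z, w)) < delta)%R.
    rewrite E.
    eapply Rle_lt_trans; [exact (prod_norm_le h k)|lra]. }
  specialize (H B).
  change (⟦f (z + h, w + k) - f (z, w) -
    l (@minus (prod_AbelianGroup C_AbelianGroup C_AbelianGroup) (z + h, w + k)%C (z, w))⟧
    <= eps * @norm _ (prod_NormedModule C_AbsRing C_NormedModule C_NormedModule)
      (@minus (prod_AbelianGroup C_AbelianGroup C_AbelianGroup) (z + h, w + k)%C (z, w)))%R in H.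
  rewrite E, El in H.
  eapply Rle_trans; [exact H|].
  apply Rmult_le_compat_l; [lra|exact (prod_norm_le h k)].
Qed.

Lemma cder2_filterdiff (f : C * C -> C) (p : C * C) (a b : C) :
  cder2 f p a b ->
  @filterdiff C_AbsRing
      (prod_NormedModule C_AbsRing C_NormedModule C_NormedModule)
      C_NormedModule f (locally p) (fun h => a * fst h + b * snd h).
Proof.
  intros H; split.
  - split.
    + intros x y; refine ((_ : @eq C (a * (fst x + fst y) + b * (snd x + snd y))
       ((a * fst x + b * snd x) + (a * fst y + b * snd y)))); ring.
    + intros k x; refine ((_ : @eq C (a * (k * fst x) + b * (k * snd x))
       (k * (a * fst x + b * snd x)))); ring.
    + exists (Cmod a + Cmod b + 1)%R.
      pose proof (Cmod_ge_0 a); pose proof (Cmod_ge_0 b).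
      split; [lra|].
      intros [x y]; destruct (le_prod_norm x y) as [Hx Hy].
      change (⟦a * x + b * y⟧ <= (Cmod a + Cmod b + 1) * 
        norm2 x y)%R.
      eapply Rle_trans; [apply Cmod_triangle|]; rewrite !Cmod_mult.
      pose proof (Cmod_ge_0 x); pose proof (Cmod_ge_0 y).
      pose proof (Rmult_le_compat_l _ _ _ H0 Hx).
      pose proof (Rmult_le_compat_l _ _ _ H1 Hy); lra.
  - intros x Hx.
    apply (is_filter_lim_locally_unique
      (V := prod_NormedModule C_AbsRing C_NormedModule C_NormedModule)) in Hx; subst x.
    intros eps.
    (* Halved because |h| + |k| is at most twice the Euclidean norm. *)
    assert (He : (0 < eps / 2)%R) by (pose proof (cond_pos eps); lra).
    destruct (H _ He) as [delta [Hd Hf]].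
    apply (locally_le_locally_norm
      (V := prod_NormedModule C_AbsRing C_NormedModule C_NormedModule)).
    exists (mkposreal _ Hd); intros [y1 y2] Hy.
    destruct p as [z w]; simpl fst in *; simpl snd in *.
    change (norm2 (y1 - z) (y2 - w) < delta)%R in Hy.
    change (⟦f (y1, y2) - f (z, w) - (a * (y1 - z) + b * (y2 - w))⟧
       <= eps * norm2 (y1 - z) (y2 - w))%R.
    destruct (le_prod_norm (y1 - z) (y2 - w)) as [H1 H2].
    specialize (Hf (y1 - z) (y2 - w) ltac:(lra) ltac:(lra)).
    rewrite !Cplus_minus in Hf.
    eapply Rle_trans; [exact Hf|].
    pose proof (cond_pos eps); nra.
Qed.

Lemma entire2_cder2 (f : C * C -> C) :
  entire2 f <-> forall p, exists a b, cder2 f p a b.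
Proof.
  split; intros H p.
  - apply filterdiff_cder2, H.
  - destruct (H p) as [a [b Hab]]; eexists; apply cder2_filterdiff, Hab.
Qed.

Lemma entire2_ext (f g : C * C -> C) :
  (forall z w, f (z, w) = g (z, w)) -> entire2 f -> entire2 g.
Proof.
  intros E H; replace g with f; [exact H|].
  apply functional_extensionality; intros [z w]; apply E.
Qed.

Lemma entire2_const (c : C) : entire2 (fun _ => c).
Proof.
  intros p; eexists; apply (filterdiff_const (V := C_NormedModule) c).
Qed.

Lemma entire2_fst : entire2 fst.
Proof.
  apply entire2_cder2; intros [z w]; exists (RtoC 1), (RtoC 0); intros eps He.
  exists 1%R; split; [lra|]; intros h k _ _; simpl.
  replace (z + h - z - (1 * h + 0 * k)) with (RtoC 0) by ring.
  rewrite Cmod_0; pose proof (Cmod_ge_0 h); pose proof (Cmod_ge_0 k); nra.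
Qed.

Lemma entire2_snd : entire2 snd.
Proof.
  apply entire2_cder2; intros [z w]; exists (RtoC 0), (RtoC 1); intros eps He.
  exists 1%R; split; [lra|]; intros h k _ _; simpl.
  replace (w + k - w - (0 * h + 1 * k)) with (RtoC 0) by ring.
  rewrite Cmod_0; pose proof (Cmod_ge_0 h); pose proof (Cmod_ge_0 k); nra.
Qed.

Lemma entire2_plus (f g : C * C -> C) :
  entire2 f -> entire2 g -> entire2 (fun p => f p + g p).
Proof.
  intros Hf Hg p; destruct (Hf p) as [lf Lf]; destruct (Hg p) as [lg Lg].
  eexists; exact (filterdiff_plus_fct f g lf lg Lf Lg).
Qed.

(* [C_NormedModule] and [AbsRing_NormedModule C_AbsRing] share their operations and norm
   but not their uniform structure, so the two notions of differential only agree
   after rebuilding the linearity record. *)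
Lemma filterdiff_C_AbsRing {U : NormedModule C_AbsRing} (f l : U -> C)
    (F : (U -> Prop) -> Prop) :
  @filterdiff C_AbsRing U C_NormedModule f F l <->
  @filterdiff C_AbsRing U (AbsRing_NormedModule C_AbsRing) f F l.
Proof.
  split; intros [[H1 H2 H3] H]; (split; [split; [exact H1|exact H2|exact H3]|exact H]).
Qed.

Lemma entire2_mult (f g : C * C -> C) :
  entire2 f -> entire2 g -> entire2 (fun p => f p * g p).
Proof.
  intros Hf Hg p; destruct (Hf p) as [lf Lf]; destruct (Hg p) as [lg Lg].
  apply filterdiff_C_AbsRing in Lf; apply filterdiff_C_AbsRing in Lg.
  eexists; apply filterdiff_C_AbsRing.
  exact (filterdiff_mult_fct (K := C_AbsRing)
   (U := prod_NormedModule C_AbsRing C_NormedModule C_NormedModule)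
   f g p lf lg Cmult_comm Lf Lg).
Qed.

Lemma entire2_opp (f : C * C -> C) : entire2 f -> entire2 (fun p => - f p).
Proof.
  intros Hf; apply (entire2_ext (fun p => (- (1)) * f p)); [intros; ring|].
  apply entire2_mult; [apply entire2_const|exact Hf].
Qed.

Lemma entire2_minus (f g : C * C -> C) :
  entire2 f -> entire2 g -> entire2 (fun p => f p - g p).
Proof.
  intros Hf Hg; apply entire2_plus; [exact Hf|apply entire2_opp, Hg].
Qed.

Lemma entire2_pow (f : C * C -> C) (n : nat) :
  entire2 f -> entire2 (fun p => f p ^ n).
Proof.
  intros Hf; induction n as [|n IH]; [exact (entire2_const 1)|].
  exact (entire2_mult _ _ Hf IH).
Qed.

Lemma entire2_continuous (f : C * C -> C) (p : C * C) :
  entire2 f -> forall eps, (0 < eps)%R -> exists delta, (0 < delta)%R /\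
  forall h k, (Cmod h < delta)%R -> (Cmod k < delta)%R ->
  (⟦f (fst p + h, snd p + k) - f p⟧ < eps)%R.
Proof.
  intros Hf eps He.
  destruct (proj1 (entire2_cder2 f) Hf p) as [a [b H]].
  destruct (H 1%R ltac:(lra)) as [d [Hd Hb]].
  pose proof (Cmod_ge_0 a) as Ha0; pose proof (Cmod_ge_0 b) as Hb0.
  (* With error constant 1, the first-order expansion bounds the increment by M (|h| + |k|). *)
  set (M := (Cmod a + Cmod b + 2)%R).
  assert (HM : (0 < M)%R) by (unfold M; lra).
  exists (Rmin d (eps / (2 * M))); split.
  { apply Rmin_pos; [lra|]; apply Rdiv_lt_0_compat; lra. }
  intros h k Hh Hk.
  pose proof (Rmin_l d (eps / (2 * M))); pose proof (Rmin_r d (eps / (2 * M))).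
  specialize (Hb h k ltac:(lra) ltac:(lra)).
  replace (f (fst p + h, snd p + k) - f p) with
    ((f (fst p + h, snd p + k) - f p - (a * h + b * k)) + (a * h + b * k)) by ring.
  eapply Rle_lt_trans; [apply Cmod_triangle|].
  assert (Hl : (⟦a * h + b * k⟧ <= Cmod a * Cmod h + Cmod b * Cmod k)%R).
  { eapply Rle_trans; [apply Cmod_triangle|]; rewrite !Cmod_mult; lra. }
  pose proof (Cmod_ge_0 h); pose proof (Cmod_ge_0 k).
  assert (Hs : (Cmod h + Cmod k < eps / M)%R).
  { replace (eps / M)%R with (eps / (2 * M) + eps / (2 * M))%R by (field; lra); lra. }
  assert (Hm : (M * (Cmod h + Cmod k) < eps)%R).
  { replace eps with (M * (eps / M))%R at 1 by (field; lra).
    apply Rmult_lt_compat_l; lra. }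
  unfold M in Hm; nra.
Qed.

(* One-variable functions are treated as functions of two variables that ignore the
   second one, so that all closure properties are shared. *)
Definition entire (f : C -> C) : Prop := entire2 (fun p => f (fst p)).

Lemma entire_cder (f : C -> C) : entire f <-> forall z, exists d, cder f z d.
Proof.
  split.
  - intros H z.
    destruct (proj1 (entire2_cder2 _) H (z, RtoC 0)) as [a [b Hab]].
    exists a; intros eps He; destruct (Hab eps He) as [delta [Hd Hf]].
    exists delta; split; [exact Hd|]; intros h Hh.
    specialize (Hf h (RtoC 0) Hh); simpl in Hf.
    rewrite Cmod_0 in Hf; specialize (Hf Hd).
    replace (f (z + h) - f z - a * h) with (f (z + h) - f z - (a * h + b * 0)) by ring.
    lra.
  - intros H; apply entire2_cder2; intros [z w].
    destruct (H z) as [d Hd]; exists d, (RtoC 0); intros eps He.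
    destruct (Hd eps He) as [delta [Hd' Hf]].
    exists delta; split; [exact Hd'|]; intros h k Hh _; simpl.
    specialize (Hf h Hh).
    replace (f (z + h) - f z - (d * h + 0 * k)) with (f (z + h) - f z - d * h) by ring.
    pose proof (Cmod_ge_0 k); nra.
Qed.

Lemma entire2_comp (phi : C -> C) (f : C * C -> C) :
  entire phi -> entire2 f -> entire2 (fun p => phi (f p)).
Proof.
  intros Hphi Hf p; destruct (Hf p) as [lf Lf].
  destruct (proj1 (entire_cder phi) Hphi (f p)) as [d Hd].
  eexists; exact (filterdiff_comp' (K := C_AbsRing)
   (U := prod_NormedModule C_AbsRing C_NormedModule C_NormedModule)
   (V := C_NormedModule) (W := C_NormedModule) f phi p lf _ Lf (cder_filterdiff _ _ _ Hd)).
Qed.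

(** Estimates are proved in the first variable only; this symmetry carries them to the second. *)
Lemma entire2_swap (f : C * C -> C) :
  entire2 f -> entire2 (fun p => f (snd p, fst p)).
Proof.
  intros H; apply entire2_cder2; intros [z w].
  destruct (proj1 (entire2_cder2 f) H (w, z)) as [a [b Hab]].
  exists b, a; intros eps He; destruct (Hab eps He) as [d [Hd Hf]].
  exists d; split; [exact Hd|]; intros h k Hh Hk; simpl.
  specialize (Hf k h Hk Hh); simpl in Hf.
  rewrite (Cplus_comm (b * h)), (Rplus_comm (Cmod h)); exact Hf.
Qed.

Lemma entire_slice_l (f : C * C -> C) (w : C) : entire2 f -> entire (fun z => f (z, w)).
Proof.
  intros H; apply entire_cder; intros z.
  destruct (proj1 (entire2_cder2 f) H (z, w)) as [a [b Hab]].
  exists a; intros eps He; destruct (Hab eps He) as [d [Hd Hf]].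
  exists d; split; [exact Hd|]; intros h Hh.
  specialize (Hf h (RtoC 0) Hh); simpl in Hf; rewrite Cmod_0 in Hf; specialize (Hf Hd).
  replace (w + 0) with w in Hf by ring.
  replace (a * h) with (a * h + b * 0) by ring; lra.
Qed.

Lemma entire_slice_r (f : C * C -> C) (z : C) : entire2 f -> entire (fun w => f (z, w)).
Proof.
  intros H; exact (entire_slice_l _ z (entire2_swap f H)).
Qed.

(** * Goursat's theorem *)

Definition ccont (f : R -> C) : Prop :=
  forall (t eps : R), (0 < eps)%R -> exists delta : R, (0 < delta)%R /\
    forall s : R, (Rabs (s - t) < delta)%R -> (⟦f s - f t⟧ < eps)%R.

Lemma ccont_continuous (f : R -> C) (t : R) :
  ccont f -> @continuous R_UniformSpace C_R_CompleteNormedModule f t.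
Proof.
  intros Hf; apply filterlim_locally; intros eps.
  destruct (Hf t eps (cond_pos eps)) as [d [Hd H]].
  exists (mkposreal _ Hd); intros s Hs.
  apply C_NormedModule_mixin_compat1; exact (H s Hs).
Qed.

Lemma ccont_const (c : C) : ccont (fun _ => c).
Proof.
  intros t eps He; exists 1%R; split; [lra|]; intros s _.
  replace (c - c) with (RtoC 0) by ring; rewrite Cmod_0; exact He.
Qed.

Lemma ccont_pair (g h : R -> R) :
  continuity g -> continuity h -> ccont (fun t => (g t, h t)).
Proof.
  intros Hg Hh t eps He.
  assert (He2 : (0 < eps / 2)%R) by lra.
  destruct (Hg t _ He2) as [d1 [Hd1 H1]]; destruct (Hh t _ He2) as [d2 [Hd2 H2]].
  (* Continuity of real functions excludes the base point from its neighbourhoods; [T] puts it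
     back. *)
  assert (T : forall (k : R -> R) (d s : R), (forall x : R,
     D_x no_cond t x /\ Rabs (x - t) < d -> Rabs (k x - k t) < eps / 2)%R ->
     (Rabs (s - t) < d -> Rabs (k s - k t) < eps / 2)%R).
  { intros k d s Hk Hs; destruct (Req_dec t s) as [->|N].
    - rewrite Rminus_diag, Rabs_R0; exact He2.
    - apply Hk; split; [split; [exact I|exact N]|exact Hs]. }
  exists (Rmin d1 d2); split; [apply Rmin_pos; assumption|]; intros s Hs.
  pose proof (Rmin_l d1 d2); pose proof (Rmin_r d1 d2).
  pose proof (T g d1 s H1 ltac:(lra)) as G1.
  pose proof (T h d2 s H2 ltac:(lra)) as G2.
  replace ((g s, h s) - (g t, h t)) with (RtoC (g s - g t) + Ci * RtoC (h s - h t)).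
  - eapply Rle_lt_trans; [apply Cmod_triangle|].
    rewrite Cmod_mult, Cmod_Ci, !Cmod_R; lra.
  - apply injective_projections; simpl; ring.
Qed.

(** Source of the closure rules below: sum, difference and product are themselves entire functions
    on C^2. *)
Lemma ccont_comp2 (F : C * C -> C) (g h : R -> C) :
  entire2 F -> ccont g -> ccont h -> ccont (fun t => F (g t, h t)).
Proof.
  intros HF Hg Hh t eps He.
  destruct (entire2_continuous F (g t, h t) HF eps He) as [d [Hd H]].
  destruct (Hg t d Hd) as [d1 [Hd1 H1]]; destruct (Hh t d Hd) as [d2 [Hd2 H2]].
  exists (Rmin d1 d2); split; [apply Rmin_pos; assumption|]; intros s Hs.
  pose proof (Rmin_l d1 d2); pose proof (Rmin_r d1 d2).
  specialize (H (g s - g t) (h s - h t) (H1 s ltac:(lra)) (H2 s ltac:(lra))).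
  simpl in H; rewrite !Cplus_minus in H; exact H.
Qed.

Lemma ccont_comp (F : C -> C) (g : R -> C) :
  entire F -> ccont g -> ccont (fun t => F (g t)).
Proof.
  intros HF Hg; exact (ccont_comp2 _ g (fun _ => RtoC 0) HF Hg (ccont_const _)).
Qed.

Lemma ccont_plus (f g : R -> C) : ccont f -> ccont g -> ccont (fun t => f t + g t).
Proof.
  exact (ccont_comp2 (fun p => fst p + snd p) f g (entire2_plus _ _ entire2_fst entire2_snd)).
Qed.

Lemma ccont_minus (f g : R -> C) : ccont f -> ccont g -> ccont (fun t => f t - g t).
Proof.
  exact (ccont_comp2 (fun p => fst p - snd p) f g (entire2_minus _ _ entire2_fst entire2_snd)).
Qed.

Lemma ccont_mult (f g : R -> C) : ccont f -> ccont g -> ccont (fun t => f t * g t).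
Proof.
  exact (ccont_comp2 (fun p => fst p * snd p) f g (entire2_mult _ _ entire2_fst entire2_snd)).
Qed.

Lemma ccont_hline (y : R) : ccont (fun x => (x, y)).
Proof.
  apply ccont_pair; [apply derivable_continuous, derivable_id
                    |apply continuity_const; intros ? ?; reflexivity].
Qed.

Lemma ccont_vline (x : R) : ccont (fun y => (x, y)).
Proof.
  apply ccont_pair; [apply continuity_const; intros ? ?; reflexivity
                    |apply derivable_continuous, derivable_id].
Qed.

(** * Integrals of complex-valued functions over real intervals *)

Definition cint (f : R -> C) (a b : R) : C := @RInt C_R_CompleteNormedModule f a b.

Lemma cint_correct (f : R -> C) (a b : R) :
  ccont f -> @is_RInt C_R_CompleteNormedModule f a b (cint f a b).
Proof.
  intros Hf; apply (@RInt_correct C_R_CompleteNormedModule), ex_RInt_continuous.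
  intros; apply ccont_continuous, Hf.
Qed.

Lemma cint_unique (f : R -> C) (a b : R) (l : C) :
  @is_RInt C_R_CompleteNormedModule f a b l -> cint f a b = l.
Proof. apply (@is_RInt_unique C_R_CompleteNormedModule). Qed.

Lemma cint_plus (f g : R -> C) (a b : R) : ccont f -> ccont g ->
  cint (fun t => f t + g t) a b = cint f a b + cint g a b.
Proof.
  intros Hf Hg; apply cint_unique.
  exact (is_RInt_plus f g a b _ _ (cint_correct f a b Hf) (cint_correct g a b Hg)).
Qed.

(** The integral is taken in C as a real normed module, so complex homogeneity has to be checked on
    real and imaginary parts. *)
Lemma cint_scal (c : C) (f : R -> C) (a b : R) : ccont f ->
  cint (fun t => c * f t) a b = c * cint f a b.
Proof.
  intros Hf; apply cint_unique.
  pose proof (cint_correct f a b Hf) as H.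
  pose proof (is_RInt_fct_extend_fst f a b _ H) as H1.
  pose proof (is_RInt_fct_extend_snd f a b _ H) as H2.
  apply (is_RInt_fct_extend_pair (U := R_NormedModule) (V := R_NormedModule)).
  - exact (is_RInt_minus _ _ a b _ _ (is_RInt_scal _ a b (fst c) _ H1)
       (is_RInt_scal _ a b (snd c) _ H2)).
  - exact (is_RInt_plus _ _ a b _ _ (is_RInt_scal _ a b (fst c) _ H2)
       (is_RInt_scal _ a b (snd c) _ H1)).
Qed.

Lemma cint_minus (f g : R -> C) (a b : R) : ccont f -> ccont g ->
  cint (fun t => f t - g t) a b = cint f a b - cint g a b.
Proof.
  intros Hf Hg; apply cint_unique.
  exact (is_RInt_minus f g a b _ _ (cint_correct f a b Hf) (cint_correct g a b Hg)).
Qed.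

Lemma cint_const (c : C) (a b : R) : cint (fun _ => c) a b = RtoC (b - a) * c.
Proof.
  apply cint_unique.
  replace (RtoC (b - a) * c) with (@scal R_Ring C_R_CompleteNormedModule (b - a)%R c).
  - apply (@is_RInt_const C_R_CompleteNormedModule).
  - change (@eq C ((b - a) * fst c, (b - a) * snd c)%R (RtoC (b - a) * c)).
    apply injective_projections; simpl; ring.
Qed.

Lemma cint_chasles (f : R -> C) (a b c : R) : ccont f ->
  cint f a c = cint f a b + cint f b c.
Proof.
  intros Hf; apply cint_unique.
  exact (is_RInt_Chasles f a b c _ _ (cint_correct f a b Hf) (cint_correct f b c Hf)).
Qed.

Lemma cint_bound (f : R -> C) (a b M : R) : ccont f -> (a <= b)%R ->
  (forall t, (a <= t <= b)%R -> (⟦f t⟧ <= M)%R) -> (⟦cint f a b⟧ <= (b - a) * M)%R.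
Proof.
  intros Hf Hab HM.
  assert (E : forall x : C, @norm R_AbsRing C_R_CompleteNormedModule x = Cmod x).
  { intros [x1 x2]; unfold Cmod; simpl.
    change (sqrt (Rabs x1 ^ 2 + Rabs x2 ^ 2) = sqrt (x1 * (x1 * 1) + x2 * (x2 * 1)))%R.
    f_equal; rewrite !pow2_abs; ring. }
  rewrite <- E.
  apply (norm_RInt_le_const (V := C_R_CompleteNormedModule) f a b _ M Hab).
  - intros t Ht; rewrite E; exact (HM t Ht).
  - exact (cint_correct f a b Hf).
Qed.

(** The integral of F dz counterclockwise along the boundary of [a, b] x [c, d]; on the vertical
    sides dz = i dy. *)
Definition rect_int (F : C -> C) (a b c d : R) : C :=
  cint (fun x => F (x, c)) a b - cint (fun x => F (x, d)) a b +
  Ci * (cint (fun y => F (b, y)) c d - cint (fun y => F (a, y)) c d).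

(** Inner edges are traversed twice, in opposite directions. *)
Lemma rect_int_split (F : C -> C) (a m b c n d : R) : entire F ->
  rect_int F a b c d =
    rect_int F a m c n + rect_int F m b c n + rect_int F a m n d + rect_int F m b n d.
Proof.
  intros HF; unfold rect_int.
  assert (Hh : forall y, ccont (fun x => F (x, y)))
    by (intros y; exact (ccont_comp F _ HF (ccont_hline y))).
  assert (Hv : forall x, ccont (fun y => F (x, y)))
    by (intros x; exact (ccont_comp F _ HF (ccont_vline x))).
  rewrite (cint_chasles _ a m b (Hh c)), (cint_chasles _ a m b (Hh d)).
  rewrite (cint_chasles _ c n d (Hv a)), (cint_chasles _ c n d (Hv b)).
  ring.
Qed.

Lemma Cmod_pair_le (x y : R) : (⟦(x, y)⟧ <= Rabs x + Rabs y)%R.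
Proof.
  replace (x, y) with (RtoC x + Ci * RtoC y).
  - eapply Rle_trans; [apply Cmod_triangle|].
    rewrite Cmod_mult, Cmod_Ci, !Cmod_R; lra.
  - apply injective_projections; simpl; ring.
Qed.

(* An affine function has vanishing boundary integral, so only the remainder of the
   first-order expansion at [(x0, y0)] contributes. *)
Lemma rect_int_small (F : C -> C) (l : C) (a b c d x0 y0 eps : R) :
  entire F -> (0 <= eps)%R -> (a <= x0 <= b)%R -> (c <= y0 <= d)%R ->
  (forall x y, (a <= x <= b)%R -> (c <= y <= d)%R ->
    (⟦F (x, y) - F (x0, y0) - l * ((x, y) - (x0, y0))⟧ <= eps * ⟦(x, y) - (x0, y0)⟧)%R) ->
  (⟦rect_int F a b c d⟧ <= 2 * eps * ((b - a) + (d - c)) ^ 2)%R.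
Proof.
  intros HF He Hx0 Hy0 H; unfold rect_int.
  set (D := ((b - a) + (d - c))%R).
  assert (Hh : forall y, ccont (fun x => F (x, y)))
    by (intros y; exact (ccont_comp F _ HF (ccont_hline y))).
  assert (Hv : forall x, ccont (fun y => F (x, y)))
    by (intros x; exact (ccont_comp F _ HF (ccont_vline x))).
  assert (HD : forall x y, (a <= x <= b)%R -> (c <= y <= d)%R ->
    (⟦F (x, y) - F (x0, y0) - l * ((x, y) - (x0, y0))⟧ <= eps * D)%R).
  { intros x y Hx Hy; eapply Rle_trans; [exact (H x y Hx Hy)|].
    apply Rmult_le_compat_l; [exact He|].
    change ((x, y) - (x0, y0)) with ((x - x0)%R, (y - y0)%R).
    eapply Rle_trans; [apply Cmod_pair_le|]; unfold D.
    pose proof (Rabs_le_between (x - x0) (b - a)); pose proof (Rabs_le_between (y - y0) (d - c)).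
    assert (Rabs (x - x0) <= b - a)%R by (apply H0; lra).
    assert (Rabs (y - y0) <= d - c)%R by (apply H1; lra). lra. }
  rewrite <- !cint_minus by auto.
  (* [u] and [v] are the differences of the linear part between opposite sides; (b - a) u + i (d -
     c) v = 0. What remains of each integrand is two remainders, each at most [eps * D], over total
     length [D]. *)
  set (u := l * (Ci * RtoC (c - d))); set (v := l * RtoC (b - a)).
  assert (B1 : (⟦cint (fun t => F (t, c) - F (t, d) - u) a b⟧ <= (b - a) * (2 * eps * D))%R).
  { apply cint_bound; [|lra|].
    - apply ccont_minus; [apply ccont_minus; auto|apply ccont_const].
    - intros t Ht.
      replace (F (t, c) - F (t, d) - u) with
       ((F (t, c) - F (x0, y0) - l * ((t, c) - (x0, y0))) +
       - (F (t, d) - F (x0, y0) - l * ((t, d) - (x0, y0)))).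
      + eapply Rle_trans; [apply Cmod_triangle|]; rewrite Cmod_opp.
        pose proof (HD t c Ht ltac:(lra)); pose proof (HD t d Ht ltac:(lra)); lra.
      + unfold u.
        replace (Ci * RtoC (c - d)) with ((t, c) - (t, d)); [ring|].
        apply injective_projections; simpl; ring. }
  assert (B2 : (⟦cint (fun t => F (b, t) - F (a, t) - v) c d⟧ <= (d - c) * (2 * eps * D))%R).
  { apply cint_bound; [|lra|].
    - apply ccont_minus; [apply ccont_minus; auto|apply ccont_const].
    - intros t Ht.
      replace (F (b, t) - F (a, t) - v) with
       ((F (b, t) - F (x0, y0) - l * ((b, t) - (x0, y0))) +
       - (F (a, t) - F (x0, y0) - l * ((a, t) - (x0, y0)))).
      + eapply Rle_trans; [apply Cmod_triangle|]; rewrite Cmod_opp.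
        pose proof (HD b t ltac:(lra) Ht); pose proof (HD a t ltac:(lra) Ht); lra.
      + unfold v.
        replace (RtoC (b - a)) with ((b, t) - (a, t)); [ring|].
        apply injective_projections; simpl; ring. }
  rewrite cint_minus, cint_const in B1
    by (try apply ccont_minus; auto using ccont_const).
  rewrite cint_minus, cint_const in B2
    by (try apply ccont_minus; auto using ccont_const).
  set (I1 := cint (fun t => F (t, c) - F (t, d)) a b) in *.
  set (I2 := cint (fun t => F (b, t) - F (a, t)) c d) in *.
  replace (I1 + Ci * I2) with
    ((I1 - RtoC (b - a) * u) + Ci * (I2 - RtoC (d - c) * v)).
  - eapply Rle_trans; [apply Cmod_triangle|]; rewrite Cmod_mult, Cmod_Ci.
    replace (2 * eps * D ^ 2)%R with ((b - a) * (2 * eps * D) + (d - c) * (2 * eps * D))%R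
      by (unfold D; ring).
    lra.
  - unfold u, v; rewrite !RtoC_minus; ring.
Qed.

(** The supremum of the left endpoints works, since every right endpoint bounds them all. *)
Lemma nested_intervals (a b : nat -> R) :
  (forall n, a n <= a (S n) /\ b (S n) <= b n /\ a n <= b n)%R ->
  exists x, forall n, (a n <= x <= b n)%R.
Proof.
  intros H.
  assert (Ha : forall n m, (n <= m)%nat -> (a n <= a m)%R).
  { intros n m Hm; induction Hm as [|m Hm IH]; [lra|]; pose proof (H m); lra. }
  assert (Hb : forall n m, (n <= m)%nat -> (b m <= b n)%R).
  { intros n m Hm; induction Hm as [|m Hm IH]; [lra|]; pose proof (H m); lra. }
  assert (Hab : forall n m, (a n <= b m)%R).
  { intros n m; pose proof (Ha n (max n m) ltac:(lia)); pose proof (Hb m (max n m) ltac:(lia)).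
    pose proof (H (max n m)); lra. }
  destruct (completeness (fun x => exists n, x = a n)) as [x [Hx1 Hx2]].
  - exists (b 0%nat); intros x [n ->]; apply Hab.
  - exists (a 0%nat), 0%nat; reflexivity.
  - exists x; intros n; split.
    + apply Hx1; exists n; reflexivity.
    + apply Hx2; intros y [m ->]; apply Hab.
Qed.

Lemma halving_pow (x : R) (delta : R) : (0 < delta)%R -> exists n : nat, (x / 2 ^ n < delta)%R.
Proof.
  intros Hd.
  destruct (Rle_lt_dec x 0) as [Hx|Hx].
  { exists 0%nat; simpl; lra. }
  destruct (pow_lt_1_zero (/ 2) ltac:(rewrite Rabs_pos_eq; lra) (delta / x))
    as [n Hn]; [apply Rdiv_lt_0_compat; lra|].
  exists n; specialize (Hn n (le_n n)).
  rewrite pow_inv, Rabs_pos_eq in Hn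
    by (left; apply Rinv_0_lt_compat, pow_lt; lra).
  apply (Rmult_lt_compat_l x) in Hn; [|exact Hx].
  unfold Rdiv; replace (x * (delta / x))%R with delta in Hn by (field; lra); exact Hn.
Qed.

(* Goursat: a rectangle whose boundary integral exceeds a fixed multiple of its squared
   perimeter has a quarter with the same property, and these quarters shrink to a
   point at which [rect_int_small] is violated. *)
Theorem goursat (F : C -> C) (a b c d : R) :
  entire F -> (a <= b)%R -> (c <= d)%R -> rect_int F a b c d = 0.
Proof.
  intros HF Hab Hcd.
  destruct (Ceq_dec (rect_int F a b c d) 0) as [E|N]; [exact E|exfalso].
  apply Cmod_gt_0 in N.
  set (w := (b - a)%R); set (h := (d - c)%R).
  (* The summand 1 keeps the denominator positive for degenerate rectangles too, and the whole
     rectangle still satisfies [bad] with this constant. *)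
  set (kappa := (⟦rect_int F a b c d⟧ / (w + h + 1) ^ 2)%R).
  assert (Hk : (0 < kappa)%R) by (apply Rdiv_lt_0_compat; [exact N|apply pow_lt; unfold w, h; lra]).
  (* A triple (x, y, s) encodes the rectangle with lower left corner (x, y) and the original sides
     scaled by s. *)
  pose (bad := fun r : R * R * R => let '(x, y, s) := r in
    (⟦rect_int F x (x + s * w) y (y + s * h)⟧ >= kappa * (s * (w + h)) ^ 2)%R).
  pose (quarter := fun r r' : R * R * R => let '(x, y, s) := r in let '(x', y', s') := r' in
    s' = (s / 2)%R /\ (x' = x \/ x' = x + s / 2 * w)%R /\ (y' = y \/ y' = y + s / 2 * h)%R).
  assert (Hstep : forall r, exists r', quarter r r' /\ (bad r -> bad r')).
  { intros [[x y] s].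
    set (m := (x + s / 2 * w)%R); set (n := (y + s / 2 * h)%R).
    destruct (excluded_middle_informative (bad (x, y, s / 2)%R)) as [B|B1];
      [exists (x, y, s / 2)%R; unfold quarter; auto|].
    destruct (excluded_middle_informative (bad (m, y, s / 2)%R)) as [B|B2];
      [exists (m, y, s / 2)%R; unfold quarter; auto|].
    destruct (excluded_middle_informative (bad (x, n, s / 2)%R)) as [B|B3];
      [exists (x, n, s / 2)%R; unfold quarter; auto|].
    (* The thresholds of the four quarters add up to that of the parent, so if three quarters fail
       to be bad, the fourth is bad. *)
    exists (m, n, s / 2)%R; split; [unfold quarter; auto|].
    unfold bad in *; intros B.
    rewrite (rect_int_split F x m _ y n _ HF) in B.
    fold m in B1, B3; fold n in B1, B2.
    replace (m + s / 2 * w)%R with (x + s * w)%R in * by (unfold m; field).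
    replace (n + s / 2 * h)%R with (y + s * h)%R in * by (unfold n; field).
    pose proof (Cmod_triangle (rect_int F x m y n + rect_int F m (x + s * w) y n + rect_int F x m n (y + s * h)) (rect_int F m (x + s * w) n (y + s * h))).
    pose proof (Cmod_triangle (rect_int F x m y n + rect_int F m (x + s * w) y n) (rect_int F x m n (y + s * h))).
    pose proof (Cmod_triangle (rect_int F x m y n) (rect_int F m (x + s * w) y n)).
    replace (kappa * (s * (w + h)) ^ 2)%R with (4 * (kappa * (s / 2 * (w + h)) ^ 2))%R in B by field.
    lra. }
  pose (step := fun r => proj1_sig (constructive_indefinite_description _ (Hstep r))).
  assert (Hs : forall r, quarter r (step r) /\ (bad r -> bad (step r)))
    by (intros r; exact (proj2_sig (constructive_indefinite_description _ (Hstep r)))).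
  pose (r := fun n => Nat.iter n step (a, c, 1%R)).
  assert (Hrs : forall n, r (S n) = step (r n)) by reflexivity.
  assert (Hbad : forall n, bad (r n)).
  { intros n; induction n as [|n IH]; [|rewrite Hrs; apply Hs, IH].
    unfold r, bad; simpl.
    replace (a + 1 * w)%R with b by (unfold w; ring).
    replace (c + 1 * h)%R with d by (unfold h; ring).
    replace (⟦rect_int F a b c d⟧) with (kappa * (w + h + 1) ^ 2)%R
      by (unfold kappa; field; unfold w, h; lra).
    unfold w, h in *; nra. }
  assert (Hsize : forall n, snd (r n) = (/ 2 ^ n)%R).
  { intros n; induction n as [|n IH]; [simpl; field|].
    rewrite Hrs; destruct (Hs (r n)) as [Q _]; unfold quarter in Q.
    destruct (r n) as [[x y] s]; destruct (step (x, y, s)) as [[x' y'] s'].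
    destruct Q as [-> _]; simpl in *; rewrite IH; field; apply pow_nonzero; lra. }
  assert (Hw : (0 <= w)%R) by (unfold w; lra).
  assert (Hh : (0 <= h)%R) by (unfold h; lra).
  assert (Hmono : forall n, let '(x, y, s) := r n in let '(x', y', s') := r (S n) in
    (x <= x' /\ x' + s' * w <= x + s * w /\ x <= x + s * w /\
     y <= y' /\ y' + s' * h <= y + s * h /\ y <= y + s * h)%R).
  { intros n; rewrite Hrs; pose proof (Hsize n) as Sz.
    destruct (Hs (r n)) as [Q _]; unfold quarter in Q.
    destruct (r n) as [[x y] s]; destruct (step (x, y, s)) as [[x' y'] s']; simpl in Sz.
    assert (0 < s)%R by (rewrite Sz; apply Rinv_0_lt_compat, pow_lt; lra).
    destruct Q as [-> [[-> | ->] [-> | ->]]]; repeat split; nra. }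
  destruct (nested_intervals (fun n => fst (fst (r n)))
     (fun n => fst (fst (r n)) + snd (r n) * w)%R) as [x0 Hx0].
  { intros n; pose proof (Hmono n) as M.
    destruct (r n) as [[x y] s]; destruct (r (S n)) as [[x' y'] s']; simpl; lra. }
  destruct (nested_intervals (fun n => snd (fst (r n)))
     (fun n => snd (fst (r n)) + snd (r n) * h)%R) as [y0 Hy0].
  { intros n; pose proof (Hmono n) as M.
    destruct (r n) as [[x y] s]; destruct (r (S n)) as [[x' y'] s']; simpl; lra. }
  destruct (proj1 (entire_cder F) HF (x0, y0)) as [l Hl].
  (* With kappa / 4, [rect_int_small] yields half of the threshold in [bad]. *)
  destruct (Hl (kappa / 4)%R ltac:(lra)) as [delta [Hd Hloc]].
  destruct (halving_pow (w + h) delta Hd) as [n Hn].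
  specialize (Hx0 n); specialize (Hy0 n); specialize (Hbad n); specialize (Hsize n).
  destruct (r n) as [[x y] s]; simpl in Hx0, Hy0, Hsize; unfold bad in Hbad.
  assert (Hs0 : (0 < s)%R) by (rewrite Hsize; apply Rinv_0_lt_compat, pow_lt; lra).
  assert (Hsd : (s * (w + h) < delta)%R) by (rewrite Hsize, Rmult_comm; exact Hn).
  (* Strict positivity of the threshold is needed for the contradiction; a rectangle reduced to a
     point has integral 0 anyway. *)
  assert (Hpos : (0 < w + h)%R).
  { destruct (Rle_lt_or_eq_dec 0 (w + h) ltac:(lra)) as [P|P]; [exact P|].
    exfalso; assert (w = 0 /\ h = 0)%R as [W0 H0] by lra.
    unfold w, h in W0, H0.
    replace b with a in N by lra; replace d with c in N by lra.
    unfold rect_int, cint in N; rewrite !RInt_point in N.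
    change (@zero C_R_CompleteNormedModule) with (RtoC 0) in N.
    replace (0 - 0 + Ci * (0 - 0)) with (RtoC 0) in N by ring.
    rewrite Cmod_0 in N; lra. }
  pose proof (rect_int_small F l x (x + s * w) y (y + s * h) x0 y0 (kappa / 4)
    HF ltac:(lra) Hx0 Hy0) as Small.
  assert (P : (0 < kappa * (s * (w + h)) ^ 2)%R)
    by (apply Rmult_lt_0_compat; [lra|apply pow_lt, Rmult_lt_0_compat; lra]).
  replace (x + s * w - x + (y + s * h - y))%R with (s * (w + h))%R in Small by ring.
  enough (⟦rect_int F x (x + s * w) y (y + s * h)⟧ <= 2 * (kappa / 4) * (s * (w + h)) ^ 2)%R by lra.
  apply Small; intros x1 y1 Hx1 Hy1.
  specialize (Hloc ((x1, y1) - (x0, y0))); rewrite Cplus_minus in Hloc.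
  apply Hloc.
  change ((x1, y1) - (x0, y0)) with ((x1 - x0)%R, (y1 - y0)%R).
  eapply Rle_lt_trans; [apply Cmod_pair_le|].
  assert (Rabs (x1 - x0) <= s * w)%R by (apply Rabs_le; lra).
  assert (Rabs (y1 - y0) <= s * h)%R by (apply Rabs_le; lra).
  lra.
Qed.

(** * Cauchy's estimate and Liouville's theorem *)

Definition polar (r t : R) : C := ((r * cos t)%R, (r * sin t)%R).

Definition cexp (z : C) : C := polar (exp (fst z)) (snd z).

Lemma Cmod_polar (r t : R) : (0 <= r)%R -> ⟦polar r t⟧ = r.
Proof.
  intros Hr; unfold Cmod, polar; simpl.
  replace (r * cos t * (r * cos t * 1) + r * sin t * (r * sin t * 1))%R
    with (r ^ 2 * ((sin t)² + (cos t)²))%R by (unfold Rsqr; ring).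
  rewrite sin2_cos2, Rmult_1_r; apply sqrt_pow2, Hr.
Qed.

Lemma polar_neq_0 (r t : R) : (0 < r)%R -> polar r t <> 0.
Proof. intros Hr; apply Cmod_gt_0; rewrite Cmod_polar; lra. Qed.

Lemma ccont_polar (r : R) : ccont (polar r).
Proof.
  apply ccont_pair; apply (continuity_scal _ r); [apply continuity_cos|apply continuity_sin].
Qed.

Lemma cexp_plus (z w : C) : cexp (z + w) = cexp z * cexp w.
Proof.
  apply injective_projections; simpl; rewrite exp_plus, ?cos_plus, ?sin_plus; ring.
Qed.

Lemma cexp_neq_0 (z : C) : cexp z <> 0.
Proof. apply polar_neq_0, exp_pos. Qed.

Lemma derivable_pt_lim_0 (f : R -> R) (l eps : R) :
  derivable_pt_lim f 0 l -> (0 < eps)%R -> exists delta, (0 < delta)%R /\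
  forall h, (Rabs h < delta)%R -> (Rabs (f h - f 0 - l * h) <= eps * Rabs h)%R.
Proof.
  intros H He; destruct (H eps He) as [d Hd]; exists d; split; [apply cond_pos|].
  intros h Hh; destruct (Req_dec h 0) as [->|N].
  - replace (f 0 - f 0 - l * 0)%R with 0%R by ring; rewrite Rabs_R0; lra.
  - specialize (Hd h N Hh); rewrite Rplus_0_l in Hd.
    replace (f h - f 0 - l * h)%R with (((f h - f 0) / h - l) * h)%R by (field; exact N).
    rewrite Rabs_mult; apply Rmult_le_compat_r; [apply Rabs_pos|lra].
Qed.

Lemma Rabs_fst_le (z : C) : (Rabs (fst z) <= Cmod z)%R.
Proof. eapply Rle_trans; [apply Rmax_l|apply Rmax_Cmod]. Qed.

Lemma Rabs_snd_le (z : C) : (Rabs (snd z) <= Cmod z)%R.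
Proof. eapply Rle_trans; [apply Rmax_r|apply Rmax_Cmod]. Qed.

(** By the addition formula only the expansion at 0 matters, and it reduces to those of the real
    functions exp, cos and sin. *)
Lemma entire_cexp : entire cexp.
Proof.
  apply entire_cder; intros z; exists (cexp z); intros eps He.
  pose proof (proj1 (Cmod_gt_0 _) (cexp_neq_0 z)) as Hz.
  (* [e] bounds the relative errors of the three real expansions and also |h|. The four terms below
     then total at most 9 e |h|, and 16 leaves room. *)
  set (e := Rmin 1 (eps / (16 * Cmod (cexp z)))).
  assert (He0 : (0 < e)%R) by (apply Rmin_pos; [lra|apply Rdiv_lt_0_compat; lra]).
  assert (He1 : (e <= 1)%R) by apply Rmin_l.
  assert (He2 : (16 * Cmod (cexp z) * e <= eps)%R).
  { pose proof (Rmin_r 1 (eps / (16 * Cmod (cexp z)))) as M; fold e in M.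
    apply (Rmult_le_compat_l (16 * Cmod (cexp z))) in M; [|lra].
    replace (16 * Cmod (cexp z) * (eps / (16 * Cmod (cexp z))))%R with eps in M
      by (field; lra); exact M. }
  destruct (derivable_pt_lim_0 exp 1 e derivable_pt_lim_exp_0 He0) as [d1 [Hd1 H1]].
  pose proof (derivable_pt_lim_cos 0) as Dc; rewrite sin_0, Ropp_0 in Dc.
  destruct (derivable_pt_lim_0 cos 0 e Dc He0) as [d2 [Hd2 H2]].
  pose proof (derivable_pt_lim_sin 0) as Ds; rewrite cos_0 in Ds.
  destruct (derivable_pt_lim_0 sin 1 e Ds He0) as [d3 [Hd3 H3]].
  rewrite exp_0 in H1; rewrite cos_0 in H2; rewrite sin_0 in H3.
  exists (Rmin (Rmin d1 d2) (Rmin d3 e)); split; [apply Rmin_pos; apply Rmin_pos; assumption|].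
  intros h Hh.
  pose proof (Rmin_l (Rmin d1 d2) (Rmin d3 e)); pose proof (Rmin_r (Rmin d1 d2) (Rmin d3 e)).
  pose proof (Rmin_l d1 d2); pose proof (Rmin_r d1 d2).
  pose proof (Rmin_l d3 e); pose proof (Rmin_r d3 e).
  pose proof (Rabs_fst_le h) as Ha; pose proof (Rabs_snd_le h) as Hb.
  specialize (H1 (fst h) ltac:(lra)); specialize (H2 (snd h) ltac:(lra)).
  specialize (H3 (snd h) ltac:(lra)).
  rewrite cexp_plus.
  replace (cexp z * cexp h - cexp z - cexp z * h) with (cexp z * (cexp h - 1 - h)) by ring.
  rewrite Cmod_mult.
  enough (K : (⟦cexp h - 1 - h⟧ <= 16 * e * Cmod h)%R).
  { pose proof (Rmult_le_compat_r _ _ _ (Cmod_ge_0 h) He2).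
    pose proof (Rmult_le_compat_l _ _ _ (Rlt_le _ _ Hz) K); lra. }
  set (x := fst h) in *; set (y := snd h) in *; set (m := Cmod h) in *.
  assert (Hm : (0 <= m)%R) by apply Cmod_ge_0.
  replace (cexp h - 1 - h) with
    (((exp x - 1 - 1 * x) + exp x * (cos y - 1 - 0 * y))%R,
     ((exp x - 1) * y + exp x * (sin y - 0 - 1 * y))%R)
    by (apply injective_projections; simpl; fold x y; ring).
  eapply Rle_trans; [apply Cmod_pair_le|].
  set (A1 := (exp x - 1 - 1 * x)%R) in *; set (A2 := (cos y - 1 - 0 * y)%R) in *.
  set (A3 := (sin y - 0 - 1 * y)%R) in *.
  assert (Rabs A1 <= e * m)%R by nra.
  assert (Rabs A2 <= e * m)%R by nra.
  assert (Rabs A3 <= e * m)%R by nra.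
  assert (Hm1 : (m <= e)%R) by lra.
  assert (X1 : (Rabs (exp x - 1) <= 2 * m)%R).
  { replace (exp x - 1)%R with (A1 + x)%R by (unfold A1; ring).
    eapply Rle_trans; [apply Rabs_triang|]; nra. }
  assert (X2 : (Rabs (exp x) <= 3)%R).
  { replace (exp x) with ((exp x - 1) + 1)%R by ring.
    eapply Rle_trans; [apply Rabs_triang|]; rewrite Rabs_R1; lra. }
  pose proof (Rabs_triang A1 (exp x * A2)); pose proof (Rabs_triang ((exp x - 1) * y) (exp x * A3)).
  rewrite !Rabs_mult in *.
  pose proof (Rabs_pos (exp x)); pose proof (Rabs_pos (exp x - 1)).
  pose proof (Rabs_pos A2); pose proof (Rabs_pos A3); pose proof (Rabs_pos y).
  assert (Rabs (exp x) * Rabs A2 <= 3 * (e * m))%R by (apply Rmult_le_compat; lra).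
  assert (Rabs (exp x) * Rabs A3 <= 3 * (e * m))%R by (apply Rmult_le_compat; lra).
  assert (Rabs (exp x - 1) * Rabs y <= 2 * m * e)%R by (apply Rmult_le_compat; lra).
  nra.
Qed.

(** Goursat's theorem on a rectangle of height 2 pi: periodicity cancels the horizontal sides, so
    the vertical ones agree. *)
Lemma cint_periodic_strip (F : C -> C) (s s' : R) :
  entire F -> (forall x, F (x, (2 * PI)%R) = F (x, 0%R)) ->
  cint (fun t => F (s, t)) 0 (2 * PI) = cint (fun t => F (s', t)) 0 (2 * PI).
Proof.
  intros HF HP.
  assert (HPI : (0 <= 2 * PI)%R) by (pose proof PI_RGT_0; lra).
  assert (W : forall a b, (a <= b)%R ->
    cint (fun t => F (b, t)) 0 (2 * PI) = cint (fun t => F (a, t)) 0 (2 * PI)).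
  { intros a b Hab; pose proof (goursat F a b 0 (2 * PI) HF Hab HPI) as G.
    unfold rect_int in G.
    replace (fun x => F (x, (2 * PI)%R)) with (fun x => F (x, 0%R)) in G
      by (apply functional_extensionality; intros; symmetry; apply HP).
    set (I1 := cint (fun t => F (b, t)) 0 (2 * PI)) in *.
    set (I2 := cint (fun t => F (a, t)) 0 (2 * PI)) in *.
    replace I1 with (I2 + - Ci * (Ci * (I1 - I2))).
    - match type of G with ?A - ?A + ?B = _ => replace (A - A + B) with B in G by ring end.
      rewrite G; ring.
    - replace (- Ci * (Ci * (I1 - I2))) with (- (Ci * Ci) * (I1 - I2)) by ring.
      replace (Ci * Ci) with (- (1)) by (apply injective_projections; simpl; ring); ring. }
  destruct (Rle_dec s s'); [symmetry|]; apply W; lra.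
Qed.

(* Pulling back by [zeta |-> c + cexp zeta] turns circles around [c] into vertical
   segments, and the integral over a period does not depend on the radius; letting
   the radius tend to [0] identifies it. *)
Lemma circle_derivative (phi : C -> C) (c d : C) (r : R) :
  entire phi -> cder phi c d -> (0 < r)%R ->
  cint (fun t => (phi (c + polar r t) - phi c) * / polar r t) 0 (2 * PI) = RtoC (2 * PI) * d.
Proof.
  intros Hphi Hd Hr.
  pose proof PI_RGT_0 as HPI.
  (* Writing the quotient with [cexp (- zeta)] makes it entire at sight: no division occurs. *)
  set (F := fun zeta => (phi (c + cexp zeta) - phi c) * cexp (- zeta)).
  assert (HF : entire F).
  { unfold entire, F; apply entire2_mult.
    - apply entire2_minus; [|apply entire2_const].
      apply (entire2_comp phi); [exact Hphi|].
      apply entire2_plus; [apply entire2_const|exact entire_cexp].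
    - apply (entire2_comp cexp); [exact entire_cexp|].
      apply entire2_opp, entire2_fst. }
  assert (Inv : forall z, cexp (- z) = / cexp z).
  { intros z.
    assert (E : cexp z * cexp (- z) = 1).
    { rewrite <- cexp_plus; replace (z + - z) with (RtoC 0) by ring.
      apply injective_projections; simpl; rewrite exp_0, ?cos_0, ?sin_0; ring. }
    pose proof (cexp_neq_0 z) as N.
    replace (/ cexp z) with (/ cexp z * (cexp z * cexp (- z))) by (rewrite E; ring).
    field; exact N. }
  assert (HP : forall x, F (x, (2 * PI)%R) = F (x, 0%R)).
  { intros x; unfold F; rewrite !Inv.
    replace (cexp (x, (2 * PI)%R)) with (cexp (x, 0%R)); [reflexivity|].
    unfold cexp, polar; simpl; rewrite cos_2PI, sin_2PI, cos_0, sin_0; reflexivity. }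
  assert (FE : forall rho t, (0 < rho)%R ->
    F (ln rho, t) = (phi (c + polar rho t) - phi c) * / polar rho t).
  { intros rho t Hrho; unfold F; rewrite Inv; unfold cexp; simpl.
    rewrite exp_ln by exact Hrho; reflexivity. }
  replace (fun t => (phi (c + polar r t) - phi c) * / polar r t) with (fun t => F (ln r, t))
    by (apply functional_extensionality; intros t; apply FE, Hr).
  set (J := cint (fun t => F (ln r, t)) 0 (2 * PI)).
  assert (Small : forall eps, (0 < eps)%R -> (⟦J - RtoC (2 * PI) * d⟧ <= 2 * PI * eps)%R).
  { intros eps He; destruct (Hd eps He) as [delta [Hdelta H]].
    set (rho := (delta / 2)%R); assert (Hrho : (0 < rho)%R) by (unfold rho; lra).
    unfold J; rewrite (cint_periodic_strip F (ln r) (ln rho) HF HP).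
    assert (Hc : ccont (fun t => F (ln rho, t))) by exact (ccont_comp F _ HF (ccont_vline _)).
    replace (RtoC (2 * PI)) with (RtoC (2 * PI - 0)) by (f_equal; ring).
    rewrite <- cint_const, <- cint_minus by auto using ccont_const.
    replace (2 * PI * eps)%R with ((2 * PI - 0) * eps)%R by ring.
    apply cint_bound; [apply ccont_minus; auto using ccont_const|lra|].
    intros t _; rewrite (FE rho t Hrho).
    pose proof (polar_neq_0 rho t Hrho) as N.
    specialize (H (polar rho t)); rewrite Cmod_polar in H by lra.
    specialize (H ltac:(unfold rho; lra)).
    replace ((phi (c + polar rho t) - phi c) * / polar rho t - d) with
      ((phi (c + polar rho t) - phi c - d * polar rho t) / polar rho t) by (field; exact N).
    rewrite Cmod_div by exact N; rewrite Cmod_polar by lra.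
    apply (Rmult_le_reg_r rho); [exact Hrho|].
    unfold Rdiv; rewrite Rmult_assoc, Rinv_l by lra; lra. }
  enough (Z : J - RtoC (2 * PI) * d = 0).
  { replace J with (J - RtoC (2 * PI) * d + RtoC (2 * PI) * d) by ring; rewrite Z; ring. }
  apply Cmod_eq_0; apply Rle_antisym; [|apply Cmod_ge_0].
  apply le_epsilon; intros eps He.
  specialize (Small (eps / (2 * PI))%R ltac:(apply Rdiv_lt_0_compat; lra)).
  replace (2 * PI * (eps / (2 * PI)))%R with eps in Small by (field; lra); lra.
Qed.

Lemma ccont_circle (phi : C -> C) (c : C) (r : R) : entire phi -> (0 < r)%R ->
  ccont (fun t => phi (c + polar r t) * / polar r t).
Proof.
  intros Hphi Hr; apply ccont_mult.
  - apply (ccont_comp phi); [exact Hphi|].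
    apply ccont_plus; [apply ccont_const|apply ccont_polar].
  (* On the circle the inverse is r^(-1) e^(-it), so its continuity follows from that of the
     exponential. *)
  - replace (fun t => / polar r t) with (fun t => / RtoC r * cexp (0%R, (- t)%R)).
    + apply ccont_mult; [apply ccont_const|].
      apply ccont_comp; [exact entire_cexp|].
      apply ccont_pair; [apply continuity_const; intros ? ?; reflexivity|].
      apply (continuity_opp (fun t => t)), derivable_continuous, derivable_id.
    + apply functional_extensionality; intros t.
      assert (N : RtoC r <> 0) by (intros E; apply RtoC_inj in E; lra).
      assert (E : polar r t * cexp (0%R, (- t)%R) = RtoC r).
      { unfold cexp, polar, Cmult, RtoC; simpl; rewrite exp_0, cos_neg, sin_neg.
        apply injective_projections; simpl; [|ring].
        replace (r * cos t * (1 * cos t) - r * sin t * (1 * - sin t))%R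
          with (r * ((sin t)² + (cos t)²))%R by (unfold Rsqr; ring).
        rewrite sin2_cos2; ring. }
      pose proof (polar_neq_0 r t Hr) as Np.
      rewrite <- E at 1; field; split; [exact Np|apply cexp_neq_0].
Qed.

(** The integrand of [circle_derivative] is at most M / r over a length 2 pi. Only increments from
    the centre enter, which is what the applications to differences use. *)
Lemma cauchy_estimate (phi : C -> C) (c d : C) (r M : R) :
  entire phi -> cder phi c d -> (0 < r)%R ->
  (forall z, ⟦z⟧ = r -> (⟦phi (c + z) - phi c⟧ <= M)%R) -> (⟦d⟧ <= M / r)%R.
Proof.
  intros Hphi Hd Hr HM; pose proof PI_RGT_0 as HPI.
  pose proof (circle_derivative phi c d r Hphi Hd Hr) as E.
  assert (B : (⟦cint (fun t => (phi (c + polar r t) - phi c) * / polar r t) 0 (2 * PI)⟧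
    <= (2 * PI - 0) * (M / r))%R).
  { apply cint_bound; [|lra|].
    - apply (ccont_circle (fun z => phi z - phi c)); [|exact Hr].
      apply entire2_minus; [exact Hphi|apply entire2_const].
    - intros t _; rewrite Cmod_mult, Cmod_inv by (apply polar_neq_0, Hr).
      rewrite Cmod_polar by lra.
      apply Rmult_le_compat_r; [left; apply Rinv_0_lt_compat, Hr|].
      apply HM, Cmod_polar; lra. }
  rewrite E, Cmod_mult, Cmod_R, Rabs_pos_eq in B by lra.
  apply (Rmult_le_reg_l (2 * PI)); lra.
Qed.

(* Cauchy's estimate applied to [(z - c) phi z], whose derivative at [c] is [phi c]. *)
Theorem liouville_vanishing (phi : C -> C) :
  entire phi ->
  (forall eps, (0 < eps)%R -> exists A, forall z, (A <= Cmod z)%R -> (⟦phi z⟧ <= eps)%R) ->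
  forall c, phi c = 0.
Proof.
  intros Hphi Hinf c.
  set (psi := fun z => (z - c) * phi z).
  assert (Hpsi : entire psi).
  { unfold entire, psi; apply entire2_mult; [|exact Hphi].
    apply entire2_minus; [apply entire2_fst|apply entire2_const]. }
  assert (Hd : cder psi c (phi c)).
  { intros eps He.
    destruct (entire2_continuous _ (c, RtoC 0) Hphi eps He) as [d [Hd H]]; simpl in H.
    exists d; split; [exact Hd|]; intros h Hh; unfold psi.
    specialize (H h (RtoC 0) Hh ltac:(rewrite Cmod_0; exact Hd)).
    replace ((c + h - c) * phi (c + h) - (c - c) * phi c - phi c * h)
      with ((phi (c + h) - phi c) * h) by ring.
    rewrite Cmod_mult; apply Rmult_le_compat_r; [apply Cmod_ge_0|lra]. }
  apply Cmod_eq_0, Rle_antisym; [|apply Cmod_ge_0].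
  apply le_epsilon; intros eps He; rewrite Rplus_0_l.
  destruct (Hinf eps He) as [A HA].
  (* On this circle |c + z| >= |A| + 1, so phi is at most [eps] there and psi at most [r * eps]; the
     estimate divides by r. *)
  set (r := (Rabs A + Cmod c + 1)%R).
  assert (Hr : (0 < r)%R)
    by (unfold r; pose proof (Rabs_pos A); pose proof (Cmod_ge_0 c); lra).
  replace eps with (r * eps / r)%R by (field; lra).
  apply (cauchy_estimate psi c _ r _ Hpsi Hd Hr).
  intros z Hz; unfold psi.
  replace ((c + z - c) * phi (c + z) - (c - c) * phi c) with (z * phi (c + z)) by ring.
  rewrite Cmod_mult, Hz; apply Rmult_le_compat_l; [lra|]; apply HA.
  pose proof (Cmod_triangle (c + z) (- c)) as T; rewrite Cmod_opp in T.
  replace (c + z + - c) with z in T by ring.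
  pose proof (Rle_abs A); unfold r in Hz; lra.
Qed.

(** * Partial derivatives and division *)

Lemma cder_minus (f g : C -> C) (z a b : C) :
  cder f z a -> cder g z b -> cder (fun x => f x - g x) z (a - b).
Proof.
  intros Hf Hg eps He.
  destruct (Hf (eps / 2)%R ltac:(lra)) as [d1 [Hd1 H1]].
  destruct (Hg (eps / 2)%R ltac:(lra)) as [d2 [Hd2 H2]].
  exists (Rmin d1 d2); split; [apply Rmin_pos; assumption|]; intros h Hh.
  pose proof (Rmin_l d1 d2); pose proof (Rmin_r d1 d2).
  specialize (H1 h ltac:(lra)); specialize (H2 h ltac:(lra)).
  replace (f (z + h) - g (z + h) - (f z - g z) - (a - b) * h) with
    ((f (z + h) - f z - a * h) + - (g (z + h) - g z - b * h)) by ring.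
  eapply Rle_trans; [apply Cmod_triangle|]; rewrite Cmod_opp; lra.
Qed.

Lemma cder_linear (a z : C) : cder (fun x => a * x) z a.
Proof.
  intros eps He; exists 1%R; split; [lra|]; intros h _.
  replace (a * (z + h) - a * z - a * h) with (RtoC 0) by ring.
  rewrite Cmod_0; pose proof (Cmod_ge_0 h); nra.
Qed.

Lemma cder_square (a z : C) : cder (fun x => a * x * x) z (2 * a * z).
Proof.
  intros eps He; exists (eps / (Cmod a + 1))%R; pose proof (Cmod_ge_0 a).
  split; [apply Rdiv_lt_0_compat; lra|]; intros h Hh.
  replace (a * (z + h) * (z + h) - a * z * z - 2 * a * z * h) with (a * h * h) by ring.
  rewrite !Cmod_mult; apply Rmult_le_compat_r; [apply Cmod_ge_0|].
  apply (Rmult_lt_compat_r (Cmod a + 1)) in Hh; [|lra].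
  unfold Rdiv in Hh; rewrite Rmult_assoc, Rinv_l, Rmult_1_r in Hh by lra.
  pose proof (Cmod_ge_0 h); lra.
Qed.

Lemma cder_shift (f : C -> C) (s z d : C) :
  cder f (z + s) d -> cder (fun x => f (x + s)) z d.
Proof.
  intros Hf eps He; destruct (Hf eps He) as [d1 [Hd1 H1]].
  exists d1; split; [exact Hd1|]; intros h Hh; specialize (H1 h Hh).
  replace (z + h + s) with (z + s + h) by ring; exact H1.
Qed.

(** The real mean value theorem is applied to the projection t -> Re (conj D f(z + t(w - z))) onto
    the direction of the total increment D; its increment over [0, 1] is |D|^2. *)
Lemma Cmod_mean_value (f f' : C -> C) (z w : C) (M : R) :
  (forall x, cder f x (f' x)) ->
  (forall t, (0 <= t <= 1)%R -> (⟦f' (z + RtoC t * (w - z))⟧ <= M)%R) ->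
  (⟦f w - f z⟧ <= M * ⟦w - z⟧)%R.
Proof.
  intros Hf HM; set (h := w - z); set (D := f w - f z).
  destruct (Req_dec (Cmod D) 0) as [E|N].
  { rewrite E; apply Rmult_le_pos; [|apply Cmod_ge_0].
    eapply Rle_trans; [apply Cmod_ge_0|apply (HM 0%R); lra]. }
  assert (HD : (0 < Cmod D)%R) by (pose proof (Cmod_ge_0 D); lra).
  set (g := fun t : R => Re (Cconj D * f (z + RtoC t * h))).
  assert (Re_minus : forall x y : C, (Re x - Re y)%R = Re (x - y)) by reflexivity.
  assert (Re_scal : forall (s : R) (x : C), (Re x * s)%R = Re (x * RtoC s))
    by (intros s [x1 x2]; simpl; ring).
  destruct (MVT_cor2 g (fun t => Re (Cconj D * (f' (z + RtoC t * h) * h))) 0 1)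
    as [t [Et Ht]]; [lra| |].
  - intros t _ eps He.
    (* The factor |D| comes from the projection and |h| from the chain rule; the summand 1 covers h
       = 0, and the 2 in [eps / (2 * B)] makes the inequality strict. *)
    set (B := (Cmod D * (Cmod h + 1))%R).
    assert (HB : (0 < B)%R)
      by (apply Rmult_lt_0_compat; [exact HD|]; pose proof (Cmod_ge_0 h); lra).
    destruct (Hf (z + RtoC t * h) (eps / (2 * B))%R) as [d [Hd H]];
      [apply Rdiv_lt_0_compat; lra|].
    assert (Hd' : (0 < d / (Cmod h + 1))%R)
      by (apply Rdiv_lt_0_compat; pose proof (Cmod_ge_0 h); lra).
    exists (mkposreal _ Hd'); intros s Ns Hs; simpl in Hs.
    assert (Hsh : ⟦RtoC s * h⟧ = (Rabs s * Cmod h)%R) by (rewrite Cmod_mult, Cmod_R; reflexivity).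
    assert (Hps : (0 < Rabs s)%R) by (apply Rabs_pos_lt, Ns).
    pose proof (Cmod_ge_0 h) as Hh0.
    apply (Rmult_lt_compat_r (Cmod h + 1)) in Hs; [|lra].
    unfold Rdiv in Hs; rewrite Rmult_assoc, Rinv_l, Rmult_1_r in Hs by lra.
    specialize (H (RtoC s * h) ltac:(rewrite Hsh; nra)).
    replace (z + RtoC t * h + RtoC s * h) with (z + RtoC (t + s) * h) in H
      by (rewrite RtoC_plus; ring).
    set (Q := f (z + RtoC (t + s) * h) - f (z + RtoC t * h) - f' (z + RtoC t * h) * (RtoC s * h)) in *.
    match goal with |- (Rabs ?X < _)%R => replace X with (Re (Cconj D * Q) / s)%R end.
    + unfold Rdiv; rewrite Rabs_mult, Rabs_inv.
      apply (Rmult_lt_reg_r (Rabs s)); [exact Hps|].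
      rewrite Rmult_assoc, Rinv_l, Rmult_1_r by lra.
      eapply Rle_lt_trans; [apply re_le_Cmod|]; rewrite Cmod_mult, Cmod_conj.
      rewrite Hsh in H.
      apply Rle_lt_trans with (Cmod D * (eps / (2 * B) * (Rabs s * (Cmod h + 1))))%R.
      * apply Rmult_le_compat_l; [lra|]; eapply Rle_trans; [exact H|].
        apply Rmult_le_compat_l; [left; apply Rdiv_lt_0_compat; lra|nra].
      * replace (Cmod D * (eps / (2 * B) * (Rabs s * (Cmod h + 1))))%R
          with (eps * Rabs s / 2)%R by (unfold B; field; split; lra).
        assert (0 < eps * Rabs s)%R by (apply Rmult_lt_0_compat; assumption). lra.
    + unfold g, Q.
      replace (Cconj D * (f (z + RtoC (t + s) * h) - f (z + RtoC t * h) - f' (z + RtoC t * h) * (RtoC s * h)))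
        with (Cconj D * f (z + RtoC (t + s) * h) - Cconj D * f (z + RtoC t * h)
              - (Cconj D * (f' (z + RtoC t * h) * h)) * RtoC s) by ring.
      rewrite <- !Re_minus, <- Re_scal; field; exact Ns.
  - specialize (HM t ltac:(lra)).
    assert (E : (g 1 - g 0 = Cmod D ^ 2)%R).
    { unfold g; rewrite Re_minus.
      replace (z + RtoC 1 * h) with w by (unfold h; ring).
      replace (z + RtoC 0 * h) with z by ring.
      replace (Cconj D * f w - Cconj D * f z) with (D * Cconj D) by (unfold D; ring).
      rewrite <- Cmod2_conj; reflexivity. }
    rewrite E in Et.
    pose proof (Rle_trans _ _ _ (Rle_abs _) (re_le_Cmod (Cconj D * (f' (z + RtoC t * h) * h)))) as U.
    rewrite !Cmod_mult, Cmod_conj in U.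
    apply (Rmult_le_reg_l (Cmod D)); [exact HD|].
    fold h in HM.
    pose proof (Rmult_le_compat_r _ _ _ (Cmod_ge_0 h) HM) as V.
    apply (Rmult_le_compat_l (Cmod D)) in V; [|lra]. nra.
Qed.

Definition partials (f f1 f2 : C * C -> C) : Prop :=
  forall p, cder2 f p (f1 p) (f2 p).

Lemma entire2_partials (f : C * C -> C) :
  entire2 f -> exists f1 f2, partials f f1 f2.
Proof.
  intros H; pose proof (proj1 (entire2_cder2 f) H) as D.
  assert (D' : forall p, exists ab : C * C, cder2 f p (fst ab) (snd ab))
    by (intros p; destruct (D p) as [a [b Hab]]; exists (a, b); exact Hab).
  exists (fun p => fst (proj1_sig (constructive_indefinite_description _ (D' p)))).
  exists (fun p => snd (proj1_sig (constructive_indefinite_description _ (D' p)))).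
  intros p; exact (proj2_sig (constructive_indefinite_description _ (D' p))).
Qed.

Lemma partials_entire2 (f f1 f2 : C * C -> C) : partials f f1 f2 -> entire2 f.
Proof. intros H; apply entire2_cder2; intros p; exists (f1 p), (f2 p); apply H. Qed.

Lemma partials_swap (f f1 f2 : C * C -> C) : partials f f1 f2 ->
  partials (fun p => f (snd p, fst p)) (fun p => f2 (snd p, fst p)) (fun p => f1 (snd p, fst p)).
Proof.
  intros Hf [z w] eps He; destruct (Hf (w, z) eps He) as [d [Hd H]].
  exists d; split; [exact Hd|]; intros h k Hh Hk; simpl.
  specialize (H k h Hk Hh); simpl in H.
  rewrite (Cplus_comm (f2 _ * h)), (Rplus_comm (Cmod h)); exact H.
Qed.

Lemma partials_slice (f f1 f2 : C * C -> C) (w z : C) :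
  partials f f1 f2 -> cder (fun x => f (x, w)) z (f1 (z, w)).
Proof.
  intros Hf eps He; destruct (Hf (z, w) eps He) as [d [Hd H]].
  exists d; split; [exact Hd|]; intros h Hh; specialize (H h (RtoC 0) Hh).
  simpl in H; rewrite Cmod_0 in H; specialize (H Hd).
  replace (w + 0) with w in H by ring.
  replace (f1 (z, w) * h) with (f1 (z, w) * h + f2 (z, w) * 0) by ring; lra.
Qed.

Definition polydisc (z0 w0 : C) (r : R) (p : C * C) : Prop :=
  (⟦fst p - z0⟧ < r)%R /\ (⟦snd p - w0⟧ < r)%R.

Definition lipschitz_on (S : C * C -> Prop) (L : R) (f : C * C -> C) : Prop :=
  forall z w z' w', S (z, w) -> S (z', w') ->
  (⟦f (z', w') - f (z, w)⟧ <= L * (⟦z' - z⟧ + ⟦w' - w⟧))%R.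

Lemma disc_convex (z0 z w : C) (r t : R) : (⟦z - z0⟧ < r)%R -> (⟦w - z0⟧ < r)%R ->
  (0 <= t <= 1)%R -> (⟦z + RtoC t * (w - z) - z0⟧ < r)%R.
Proof.
  intros Hz Hw Ht.
  replace (z + RtoC t * (w - z) - z0) with (RtoC (1 - t) * (z - z0) + RtoC t * (w - z0))
    by (rewrite RtoC_minus; ring).
  eapply Rle_lt_trans; [apply Cmod_triangle|].
  rewrite !Cmod_mult, !Cmod_R, !Rabs_pos_eq by lra.
  destruct (Req_dec t 0) as [->|N]; [lra|].
  assert (t * ⟦w - z0⟧ < t * r)%R by (apply Rmult_lt_compat_l; lra).
  assert ((1 - t) * ⟦z - z0⟧ <= (1 - t) * r)%R by (apply Rmult_le_compat_l; lra).
  lra.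
Qed.

Lemma Cmod_segment_le (z w : C) (t : R) :
  (0 <= t <= 1)%R -> (⟦z + RtoC t * (w - z) - z⟧ <= ⟦w - z⟧)%R.
Proof.
  intros Ht; replace (z + RtoC t * (w - z) - z) with (RtoC t * (w - z)) by ring.
  rewrite Cmod_mult, Cmod_R, Rabs_pos_eq by lra; pose proof (Cmod_ge_0 (w - z)); nra.
Qed.

(** A circle of radius r / 2 about a point of the half-size polydisc stays in the large one, where f
    varies by at most 2 M. *)
Lemma partials_bound (f f1 f2 : C * C -> C) (z0 w0 : C) (r M : R) :
  partials f f1 f2 -> (0 < r)%R ->
  (forall p, polydisc z0 w0 r p -> (⟦f p⟧ <= M)%R) ->
  forall p, polydisc z0 w0 (r / 2) p -> (⟦f1 p⟧ <= 4 * M / r)%R.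
Proof.
  intros Hf Hr HM [z w] [Hz Hw]; simpl in Hz, Hw.
  replace (4 * M / r)%R with (2 * M / (r / 2))%R by (field; lra).
  apply (cauchy_estimate (fun x => f (x, w)) z).
  - apply entire_slice_l, (partials_entire2 _ _ _ Hf).
  - exact (partials_slice _ _ _ w z Hf).
  - lra.
  - intros x Hx; unfold Cminus at 1.
    eapply Rle_trans; [apply Cmod_triangle|]; rewrite Cmod_opp.
    assert (⟦f (z + x, w)⟧ <= M)%R.
    { apply HM; split; simpl; [|lra].
      replace (z + x - z0) with ((z - z0) + x) by ring.
      eapply Rle_lt_trans; [apply Cmod_triangle|]; lra. }
    assert (⟦f (z, w)⟧ <= M)%R by (apply HM; split; simpl; lra).
    lra.
Qed.

(** The two points are joined by two segments parallel to the axes, which stay in the polydisc by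
    convexity. *)
Lemma partials_lipschitz_of_bound (f f1 f2 : C * C -> C) (z0 w0 : C) (r L : R) :
  partials f f1 f2 ->
  (forall p, polydisc z0 w0 r p -> (⟦f1 p⟧ <= L)%R /\ (⟦f2 p⟧ <= L)%R) ->
  lipschitz_on (polydisc z0 w0 r) L f.
Proof.
  intros Hf HL z w z' w' [Hz Hw] [Hz' Hw']; simpl in *.
  replace (f (z', w') - f (z, w)) with
    ((f (z', w') - f (z, w')) + (f (z, w') - f (z, w))) by ring.
  eapply Rle_trans; [apply Cmod_triangle|]; rewrite Rmult_plus_distr_l.
  apply Rplus_le_compat.
  - apply (Cmod_mean_value (fun x => f (x, w')) (fun x => f1 (x, w')));
      [intros x; exact (partials_slice _ _ _ w' x Hf)|].
    intros t Ht; apply (HL (_, _)); split; [apply disc_convex; assumption|exact Hw'].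
  - apply (Cmod_mean_value (fun x => f (z, x)) (fun x => f2 (z, x)));
      [intros x; exact (partials_slice _ _ _ z x (partials_swap _ _ _ Hf))|].
    intros t Ht; apply (HL (_, _)); split; [exact Hz|apply disc_convex; assumption].
Qed.

(** The increment of [f1] is the derivative at z of x -> f(x + z' - z, w') - f(x, w), a function
    bounded by L times the distance of the two points; Cauchy's estimate does the rest. *)
Lemma partial_lipschitz (f f1 f2 : C * C -> C) (z0 w0 : C) (r L : R) :
  partials f f1 f2 -> (0 < r)%R -> lipschitz_on (polydisc z0 w0 r) L f ->
  lipschitz_on (polydisc z0 w0 (r / 2)) (4 * L / r) f1.
Proof.
  intros Hf Hr HL z w z' w' [Hz Hw] [Hz' Hw']; simpl in *.
  set (D := (⟦z' - z⟧ + ⟦w' - w⟧)%R).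
  replace (4 * L / r * D)%R with (2 * (L * D) / (r / 2))%R by (field; lra).
  apply (cauchy_estimate (fun x => f (x + (z' - z), w') - f (x, w)) z).
  - apply entire2_minus.
    + apply (entire2_comp (fun x => f (x, w'))).
      * apply entire_slice_l, (partials_entire2 _ _ _ Hf).
      * apply entire2_plus; [apply entire2_fst|apply entire2_const].
    + apply (entire_slice_l f w), (partials_entire2 _ _ _ Hf).
  - apply cder_minus; [|exact (partials_slice _ _ _ w z Hf)].
    apply (cder_shift (fun x => f (x, w'))); rewrite Cplus_minus.
    exact (partials_slice _ _ _ w' z' Hf).
  - lra.
  - intros x Hx; rewrite Cplus_minus.
    replace (z + x + (z' - z)) with (z' + x) by ring.
    unfold Cminus at 1; eapply Rle_trans; [apply Cmod_triangle|]; rewrite Cmod_opp.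
    assert (H1 : (⟦f (z' + x, w') - f (z + x, w)⟧ <= L * D)%R).
    { replace D with (⟦z' + x - (z + x)⟧ + ⟦w' - w⟧)%R
        by (unfold D; do 2 f_equal; ring).
      apply HL; split; simpl; try lra.
      - replace (z + x - z0) with ((z - z0) + x) by ring.
        eapply Rle_lt_trans; [apply Cmod_triangle|]; lra.
      - replace (z' + x - z0) with ((z' - z0) + x) by ring.
        eapply Rle_lt_trans; [apply Cmod_triangle|]; lra. }
    assert (H2 : (⟦f (z', w') - f (z, w)⟧ <= L * D)%R)
      by (apply HL; split; simpl; lra).
    lra.
Qed.

Definition taylor_on (S : C * C -> Prop) (K : R) (f f1 f2 : C * C -> C) : Prop :=
  forall z w z' w', S (z, w) -> S (z', w') ->
  (⟦f (z', w') - f (z, w) - (f1 (z, w) * (z' - z) + f2 (z, w) * (w' - w))⟧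
    <= K * (⟦z' - z⟧ + ⟦w' - w⟧) ^ 2)%R.

(** After subtraction of the linear part, the derivatives along an axis-parallel path are increments
    of [f1] and [f2], hence at most K times the distance. *)
Lemma partials_taylor (f f1 f2 : C * C -> C) (z0 w0 : C) (r K : R) :
  partials f f1 f2 -> (0 <= K)%R -> lipschitz_on (polydisc z0 w0 r) K f1 ->
  lipschitz_on (polydisc z0 w0 r) K f2 -> taylor_on (polydisc z0 w0 r) K f f1 f2.
Proof.
  intros Hf HK H1 H2 z w z' w' [Hz Hw] [Hz' Hw']; simpl in *.
  set (a := f1 (z, w)); set (b := f2 (z, w)); set (D := (⟦z' - z⟧ + ⟦w' - w⟧)%R).
  assert (B1 : (⟦(f (z', w') - a * z') - (f (z, w') - a * z)⟧ <= K * D * ⟦z' - z⟧)%R).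
  { apply (Cmod_mean_value (fun x => f (x, w') - a * x) (fun x => f1 (x, w') - a)).
    - intros x; apply cder_minus; [exact (partials_slice _ _ _ w' x Hf)|apply cder_linear].
    - intros t Ht; eapply Rle_trans.
      + apply (H1 z w); split; simpl; try assumption; apply disc_convex; assumption.
      + apply Rmult_le_compat_l; [exact HK|]; unfold D.
        pose proof (Cmod_segment_le z z' t Ht); lra. }
  assert (B2 : (⟦(f (z, w') - b * w') - (f (z, w) - b * w)⟧ <= K * D * ⟦w' - w⟧)%R).
  { apply (Cmod_mean_value (fun x => f (z, x) - b * x) (fun x => f2 (z, x) - b)).
    - intros x; apply cder_minus; [|apply cder_linear].
      exact (partials_slice _ _ _ z x (partials_swap _ _ _ Hf)).
    - intros t Ht; eapply Rle_trans.
      + apply (H2 z w); split; simpl; try assumption; apply disc_convex; assumption.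
      + apply Rmult_le_compat_l; [exact HK|]; unfold D.
        pose proof (Cmod_segment_le w w' t Ht); pose proof (Cmod_ge_0 (z' - z)).
        replace (z - z) with (RtoC 0) by ring; rewrite Cmod_0; lra. }
  replace (f (z', w') - f (z, w) - (a * (z' - z) + b * (w' - w))) with
    (((f (z', w') - a * z') - (f (z, w') - a * z)) +
     ((f (z, w') - b * w') - (f (z, w) - b * w))) by ring.
  eapply Rle_trans; [apply Cmod_triangle|]; unfold D in *; nra.
Qed.

Lemma polydisc_swap (z0 w0 : C) (r : R) (z w : C) :
  polydisc z0 w0 r (z, w) <-> polydisc w0 z0 r (w, z).
Proof. unfold polydisc; simpl; tauto. Qed.

(** Continuity bounds f near the point, one halving of the radius makes f Lipschitz, and a second
    one makes its partial derivatives Lipschitz. *)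
Lemma local_taylor (f f1 f2 : C * C -> C) (z0 w0 : C) :
  partials f f1 f2 -> exists r K, (0 < r)%R /\ (0 <= K)%R /\
  lipschitz_on (polydisc z0 w0 r) K f1 /\ lipschitz_on (polydisc z0 w0 r) K f2 /\
  taylor_on (polydisc z0 w0 r) K f f1 f2.
Proof.
  intros Hf.
  pose proof (partials_swap _ _ _ Hf) as Hs.
  destruct (entire2_continuous f (z0, w0) (partials_entire2 _ _ _ Hf) 1 ltac:(lra))
    as [r [Hr HM]]; simpl in HM.
  set (M := (⟦f (z0, w0)⟧ + 1)%R).
  assert (HM' : forall p, polydisc z0 w0 r p -> (⟦f p⟧ <= M)%R).
  { intros [z w] [Hz Hw]; simpl in *.
    specialize (HM (z - z0) (w - w0) Hz Hw); rewrite !Cplus_minus in HM.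
    replace (f (z, w)) with ((f (z, w) - f (z0, w0)) + f (z0, w0)) by ring.
    eapply Rle_trans; [apply Cmod_triangle|]; unfold M; lra. }
  set (L := (4 * M / r)%R).
  assert (HL : lipschitz_on (polydisc z0 w0 (r / 2)) L f).
  { apply (partials_lipschitz_of_bound f f1 f2); [exact Hf|]; intros p Hp; split.
    - exact (partials_bound f f1 f2 z0 w0 r M Hf Hr HM' p Hp).
    - destruct p as [z w]; apply polydisc_swap in Hp.
      apply (partials_bound _ _ _ w0 z0 r M Hs Hr) with (p := (w, z)); [|exact Hp].
      intros [y x] Hp'; apply HM'; simpl; apply polydisc_swap, Hp'. }
  assert (HL' : lipschitz_on (polydisc w0 z0 (r / 2)) L (fun p => f (snd p, fst p))).
  { intros w z w' z' H H'; simpl; rewrite Rplus_comm.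
    apply HL; apply polydisc_swap; assumption. }
  set (K := (4 * L / (r / 2))%R).
  exists (r / 2 / 2)%R, K.
  assert (HK : (0 <= K)%R).
  { unfold K, L, M; pose proof (Cmod_ge_0 (f (z0, w0))).
    repeat (apply Rdiv_le_0_compat || apply Rmult_le_pos); lra. }
  assert (K1 : lipschitz_on (polydisc z0 w0 (r / 2 / 2)) K f1)
    by (apply (partial_lipschitz f f1 f2); [exact Hf|lra|exact HL]).
  assert (K2 : lipschitz_on (polydisc z0 w0 (r / 2 / 2)) K f2).
  { intros z w z' w' H H'; rewrite Rplus_comm.
    apply (partial_lipschitz _ _ _ w0 z0 (r / 2) L Hs ltac:(lra) HL' w z w' z');
      apply polydisc_swap; assumption. }
  repeat split; try assumption; [lra|].
  apply partials_taylor; assumption.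
Qed.

(** Serves the partial derivatives at a stage where they are known to be Lipschitz but not yet
    entire. *)
Lemma ccont_lipschitz (f : C * C -> C) (z0 w0 : C) (r K rho : R) :
  (0 < rho < r)%R -> (0 <= K)%R -> lipschitz_on (polydisc z0 w0 r) K f ->
  ccont (fun t => f (z0 + polar rho t, w0)).
Proof.
  intros Hrho HK HL t eps He.
  destruct (ccont_polar rho t (eps / (K + 1))%R) as [d [Hd H]];
    [apply Rdiv_lt_0_compat; lra|].
  exists d; split; [exact Hd|]; intros s Hs; specialize (H s Hs).
  assert (P : forall u, polydisc z0 w0 r (z0 + polar rho u, w0)).
  { intros u; split; simpl.
    - replace (z0 + polar rho u - z0) with (polar rho u) by ring.
      rewrite Cmod_polar; lra.
    - replace (w0 - w0) with (RtoC 0) by ring; rewrite Cmod_0; lra. }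
  eapply Rle_lt_trans; [apply HL; apply P|].
  replace (z0 + polar rho s - (z0 + polar rho t)) with (polar rho s - polar rho t) by ring.
  replace (w0 - w0) with (RtoC 0) by ring; rewrite Cmod_0, Rplus_0_r.
  apply (Rmult_lt_compat_l (K + 1)) in H; [|lra].
  replace ((K + 1) * (eps / (K + 1)))%R with eps in H by (field; lra).
  pose proof (Cmod_ge_0 (polar rho s - polar rho t)); lra.
Qed.

(* Differentiation under the integral sign in [circle_derivative]. *)
Theorem partial_entire2 (f f1 f2 : C * C -> C) : partials f f1 f2 -> entire2 f1.
Proof.
  intros Hf; apply entire2_cder2; intros [z0 w0].
  pose proof (partials_entire2 _ _ _ Hf) as Ef.
  destruct (local_taylor f f1 f2 z0 w0 Hf) as (r & K & Hr & HK & H1 & H2 & HT).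
  (* Half of r, so that z0 + h + e stays in the polydisc for |h| < rho and |e| = rho. *)
  set (rho := (r / 2)%R); assert (Hrho : (0 < rho)%R) by (unfold rho; lra).
  pose proof PI_RGT_0 as HPI.
  set (T := (2 * PI)%R); assert (HTp : (0 < T)%R) by (unfold T; lra).
  assert (NT : RtoC T <> 0) by (intros E; apply RtoC_inj in E; lra).
  set (g := fun i : C * C -> C => fun t => (i (z0 + polar rho t, w0) - i (z0, w0)) * / polar rho t).
  (* The candidates arise by replacing f by [f1] and [f2] in the circle formula for [f1]. *)
  set (a := / RtoC T * cint (g f1) 0 T); set (b := / RtoC T * cint (g f2) 0 T).
  exists a, b.
  assert (Cinvp : ccont (fun t => / polar rho t)).
  { replace (fun t => / polar rho t) with (fun t => 1 * / polar rho t)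
      by (apply functional_extensionality; intros; ring).
    exact (ccont_circle (fun _ => RtoC 1) z0 rho (entire2_const _) Hrho). }
  assert (Cg : forall i, ccont (fun t => i (z0 + polar rho t, w0)) -> ccont (g i)).
  { intros i Hi; apply ccont_mult; [|exact Cinvp].
    apply ccont_minus; [exact Hi|apply ccont_const]. }
  assert (C1 : ccont (g f1)) by (apply Cg, (ccont_lipschitz f1 z0 w0 r K); unfold rho; auto; lra).
  assert (C2 : ccont (g f2)) by (apply Cg, (ccont_lipschitz f2 z0 w0 r K); unfold rho; auto; lra).
  assert (Est : forall h k, (⟦h⟧ < rho)%R -> (⟦k⟧ < rho)%R ->
    (⟦f1 (z0 + h, w0 + k) - f1 (z0, w0) - (a * h + b * k)⟧ <= 2 * K * (Cmod h + Cmod k) ^ 2 / rho)%R).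
  { intros h k Hh Hk.
    pose proof (circle_derivative (fun x => f (x, w0)) z0 _ rho (entire_slice_l f w0 Ef)
      (partials_slice _ _ _ w0 z0 Hf) Hrho) as E0.
    pose proof (circle_derivative (fun x => f (x, w0 + k)) (z0 + h) _ rho (entire_slice_l f (w0 + k) Ef)
      (partials_slice _ _ _ (w0 + k) (z0 + h) Hf) Hrho) as E1.
    cbv beta in E0, E1; fold T in E0, E1.
    set (G := fun t => (f (z0 + h + polar rho t, w0 + k) - f (z0 + h, w0 + k)) * / polar rho t) in *.
    assert (C0 : ccont (g f)).
    { apply Cg; apply (ccont_comp (fun x => f (x, w0))); [apply entire_slice_l, Ef|].
      apply ccont_plus; [apply ccont_const|apply ccont_polar]. }
    assert (CG : ccont G).
    { apply (ccont_circle (fun x => f (x, w0 + k) - f (z0 + h, w0 + k))); [|exact Hrho].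
      apply entire2_minus; [apply (entire_slice_l f (w0 + k)), Ef|apply entire2_const]. }
    change (cint (g f) 0 T = RtoC T * f1 (z0, w0)) in E0.
    (* Its integral is T times the first-order remainder of [f1]. Pointwise it is the difference of
       two Taylor remainders of f, at z0 + e and at z0, divided by e, hence at most 2 K (|h| +
       |k|)^2 / rho. *)
    set (Psi := fun t => G t - g f t - (h * g f1 t + k * g f2 t)).
    assert (CP : cint Psi 0 T = RtoC T * (f1 (z0 + h, w0 + k) - f1 (z0, w0) - (a * h + b * k))).
    { unfold Psi.
      rewrite (cint_minus (fun t => G t - g f t)), (cint_minus G), cint_plus, !cint_scal, E0, E1
        by auto using ccont_minus, ccont_plus, ccont_mult, ccont_const.
      unfold a, b; field; exact NT. }
    assert (BP : (⟦cint Psi 0 T⟧ <= (T - 0) * (2 * K * (Cmod h + Cmod k) ^ 2 / rho))%R).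
    { apply cint_bound; [|lra|].
      - unfold Psi; auto 10 using ccont_minus, ccont_plus, ccont_mult, ccont_const.
      - intros t _; unfold Psi, G, g.
        pose proof (polar_neq_0 rho t Hrho) as Np.
        pose proof (Cmod_polar rho t ltac:(lra)) as Ep.
        set (e := polar rho t) in *.
        match goal with |- (⟦?X⟧ <= _)%R => replace X with
          (((f (z0 + h + e, w0 + k) - f (z0 + e, w0) - (f1 (z0 + e, w0) * h + f2 (z0 + e, w0) * k))
          + - (f (z0 + h, w0 + k) - f (z0, w0) - (f1 (z0, w0) * h + f2 (z0, w0) * k))) * / e) by ring end.
        rewrite Cmod_mult, Cmod_inv, Ep by exact Np.
        apply Rmult_le_compat_r; [left; apply Rinv_0_lt_compat, Hrho|].
        eapply Rle_trans; [apply Cmod_triangle|]; rewrite Cmod_opp.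
        assert (W0 : ⟦w0 - w0⟧ = 0%R) by (replace (w0 - w0) with (RtoC 0) by ring; apply Cmod_0).
        assert (W1 : w0 + k - w0 = k) by ring.
        pose proof (HT (z0 + e) w0 (z0 + h + e) (w0 + k)) as T1.
        pose proof (HT z0 w0 (z0 + h) (w0 + k)) as T2.
        unfold polydisc in T1, T2; simpl in T1, T2.
        replace (z0 + e - z0) with e in T1 by ring.
        replace (z0 + h + e - z0) with (h + e) in T1 by ring.
        replace (z0 + h + e - (z0 + e)) with h in T1 by ring.
        replace (z0 - z0) with (RtoC 0) in T2 by ring.
        replace (z0 + h - z0) with h in T2 by ring.
        rewrite ?W0, W1, ?Ep in T1, T2.
        pose proof (Cmod_triangle h e) as Tr; rewrite Ep in Tr.
        unfold rho in *.
        specialize (T1 ltac:(split; lra) ltac:(split; lra)).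
        specialize (T2 ltac:(split; rewrite ?Cmod_0; lra) ltac:(split; lra)).
        lra. }
    rewrite CP, Cmod_mult, Cmod_R, Rabs_pos_eq in BP by lra.
    apply (Rmult_le_reg_l T); lra. }
  intros eps He.
  (* Then s = |h| + |k| satisfies 2 (K + 1) s <= eps rho, which turns the quadratic bound into
     [eps * s]. *)
  set (d := Rmin rho (eps * rho / (4 * (K + 1)))).
  assert (Hd : (0 < d)%R).
  { apply Rmin_pos; [exact Hrho|].
    apply Rdiv_lt_0_compat; [apply Rmult_lt_0_compat|]; lra. }
  exists d; split; [exact Hd|]; intros h k Hh Hk; simpl.
  pose proof (Rmin_l rho (eps * rho / (4 * (K + 1)))) as D1; fold d in D1.
  pose proof (Rmin_r rho (eps * rho / (4 * (K + 1)))) as D2; fold d in D2.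
  eapply Rle_trans; [apply Est; lra|].
  pose proof (Cmod_ge_0 h); pose proof (Cmod_ge_0 k).
  set (s := (Cmod h + Cmod k)%R) in *.
  assert (Hs : (s <= 2 * (eps * rho / (4 * (K + 1))))%R) by (unfold s; lra).
  apply (Rmult_le_compat_l (2 * (K + 1))) in Hs; [|lra].
  replace (2 * (K + 1) * (2 * (eps * rho / (4 * (K + 1)))))%R with (eps * rho)%R in Hs
    by (field; lra).
  apply (Rmult_le_reg_r rho); [exact Hrho|].
  unfold Rdiv; rewrite Rmult_assoc, Rinv_l, Rmult_1_r by lra.
  assert (Hs0 : (0 <= s)%R) by (unfold s; lra).
  pose proof (Rmult_le_compat_r s _ _ Hs0 Hs).
  pose proof (pow2_ge_0 s); nra.
Qed.

(** By continuity; it completes identities that were obtained only where a coordinate is nonzero. *)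
Lemma entire_cder_zero_off_origin (phi : C -> C) :
  entire phi -> (forall z : C, z <> 0 -> phi z = 0) -> phi 0 = 0.
Proof.
  intros Hphi H.
  apply Cmod_eq_0, Rle_antisym; [|apply Cmod_ge_0].
  apply le_epsilon; intros eps He; rewrite Rplus_0_l.
  destruct (entire2_continuous _ (RtoC 0, RtoC 0) Hphi eps He) as [d [Hd Hc]]; simpl in Hc.
  assert (Hm : ⟦RtoC (d / 2)⟧ = (d / 2)%R) by (rewrite Cmod_R, Rabs_pos_eq; lra).
  specialize (Hc (RtoC (d / 2)) (RtoC 0) ltac:(rewrite Hm; lra) ltac:(rewrite Cmod_0; lra)).
  assert (Nd : RtoC (d / 2) <> 0) by (apply Cmod_gt_0; rewrite Hm; lra).
  rewrite Cplus_0_l, (H _ Nd) in Hc.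
  replace (0 - phi 0) with (- phi 0) in Hc by ring; rewrite Cmod_opp in Hc; lra.
Qed.

(* The quotient extends across [z = 0] by the partial derivative [f1]; the expansion of
   [f1], which is again entire, gives its differential there:
   [f (h, w) / h = f1 (0, w) + f11 (0, w) h / 2 + ...]. *)
Theorem entire2_divide_fst (f : C * C -> C) :
  entire2 f -> (forall w, f (RtoC 0, w) = 0) ->
  exists q, entire2 q /\ forall z w, f (z, w) = z * q (z, w).
Proof.
  intros Hf H0.
  destruct (entire2_partials f Hf) as (f1 & f2 & P).
  destruct (entire2_partials f1 (partial_entire2 f f1 f2 P)) as (f11 & f12 & P1).
  set (q := fun p : C * C => if Ceq_dec (fst p) 0 then f1 p else f p / fst p).
  exists q; split.
  2: { intros z w; unfold q; simpl; destruct (Ceq_dec z 0) as [->|N].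
       - rewrite H0; ring.
       - field; exact N. }
  assert (Q0 : forall w, q (RtoC 0, w) = f1 (RtoC 0, w)).
  { intros w; unfold q; simpl; destruct (Ceq_dec 0 0); [reflexivity|congruence]. }
  assert (Q1 : forall z w : C, z <> 0 -> q (z, w) = f (z, w) / z).
  { intros z w N; unfold q; simpl; destruct (Ceq_dec z 0); [congruence|reflexivity]. }
  apply entire2_cder2; intros [z0 w0].
  destruct (Ceq_dec z0 0) as [->|N].
  - exists (/ 2 * f11 (RtoC 0, w0)), (f12 (RtoC 0, w0)); intros eps He.
    destruct (local_taylor f1 f11 f12 0 w0 P1) as (r & K & Hr & HK & L1 & L2 & HT).
    (* Gives 4 (K + 1) s <= eps, enough to absorb the total error 3 K s^2 of [Hw] and [Hz]. *)
    set (d := Rmin r (eps / (8 * (K + 1)))).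
    assert (Hd : (0 < d)%R) by (apply Rmin_pos; [exact Hr|apply Rdiv_lt_0_compat; lra]).
    exists d; split; [exact Hd|]; intros h k Hh Hk.
    pose proof (Rmin_l r (eps / (8 * (K + 1)))) as D1; fold d in D1.
    pose proof (Rmin_r r (eps / (8 * (K + 1)))) as D2; fold d in D2.
    change (fst (RtoC 0, w0) + h) with (RtoC 0 + h).
    change (snd (RtoC 0, w0) + k) with (w0 + k).
    rewrite Cplus_0_l, Q0.
    set (w := w0 + k).
    set (s := (Cmod h + Cmod k)%R).
    pose proof (Cmod_ge_0 h) as Hh0; pose proof (Cmod_ge_0 k) as Hk0.
    assert (Ek : w - w0 = k) by (unfold w; ring).
    assert (Pd : forall x, (⟦x⟧ < r)%R -> polydisc 0 w0 r (x, w)).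
    { intros x Hx; split; simpl; [replace (x - 0) with x by ring; exact Hx|rewrite Ek; lra]. }
    assert (Pd0 : polydisc 0 w0 r (RtoC 0, w0)).
    { split; simpl; [replace (0 - 0) with (RtoC 0) by ring|replace (w0 - w0) with (RtoC 0) by ring];
        rewrite Cmod_0; exact Hr. }
    set (A := f11 (RtoC 0, w0)).
    assert (Hw : (⟦f1 (RtoC 0, w) - f1 (RtoC 0, w0) - f12 (RtoC 0, w0) * k⟧ <= K * s ^ 2)%R).
    { pose proof (HT 0 w0 0 w Pd0 (Pd 0 ltac:(rewrite Cmod_0; exact Hr))) as T.
      rewrite Ek in T.
      replace (0 - 0) with (RtoC 0) in T by ring; rewrite Cmod_0, Rplus_0_l in T.
      rewrite Cmult_0_r, Cplus_0_l in T.
      eapply Rle_trans; [exact T|]; apply Rmult_le_compat_l; [exact HK|].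
      unfold s; nra. }
    (* Mean value inequality for f minus its quadratic polynomial in the first variable. The
       second-order coefficient [A] is taken at w0 rather than w, so the derivative has the extra
       term (f11(0, w) - A) x, controlled by the Lipschitz bound. *)
    assert (Hz : h <> 0 -> (⟦f (h, w) / h - f1 (RtoC 0, w) - / 2 * A * h⟧ <= 2 * K * s ^ 2)%R).
    { intros Nh.
      assert (B : (⟦(f (h, w) - f1 (RtoC 0, w) * h - / 2 * A * h * h)
        - (f (RtoC 0, w) - f1 (RtoC 0, w) * 0 - / 2 * A * 0 * 0)⟧ <= 2 * K * s ^ 2 * ⟦h - 0⟧)%R).
      { apply (Cmod_mean_value (fun x => f (x, w) - f1 (RtoC 0, w) * x - / 2 * A * x * x)
          (fun x => f1 (x, w) - f1 (RtoC 0, w) - 2 * (/ 2 * A) * x)).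
        - intros x; apply cder_minus; [apply cder_minus|apply cder_square].
          + exact (partials_slice _ _ _ w x P).
          + apply cder_linear.
        - intros t Ht.
          set (x := 0 + RtoC t * (h - 0)).
          assert (Hx : (⟦x⟧ <= Cmod h)%R).
          { pose proof (Cmod_segment_le 0 h t Ht) as S.
            replace (0 + RtoC t * (h - 0) - 0) with x in S by (unfold x; ring).
            replace (h - 0) with h in S by ring; exact S. }
          assert (Hx0 : polydisc 0 w0 r (RtoC 0, w)) by (apply Pd; rewrite Cmod_0; exact Hr).
          pose proof (HT 0 w x w Hx0 (Pd x ltac:(lra))) as T.
          pose proof (L1 0 w0 0 w Pd0 Hx0) as T1; fold A in T1.
          rewrite Ek in T1; replace (0 - 0) with (RtoC 0) in T1 by ring.
          replace (w - w) with (RtoC 0) in T by ring; replace (x - 0) with x in T by ring.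
          rewrite Cmod_0 in T, T1.
          replace (f1 (x, w) - f1 (RtoC 0, w) - 2 * (/ 2 * A) * x) with
            ((f1 (x, w) - f1 (RtoC 0, w) - (f11 (RtoC 0, w) * x + f12 (RtoC 0, w) * 0))
             + (f11 (RtoC 0, w) - A) * x)
            by (field; intros E; apply RtoC_inj in E; lra).
          eapply Rle_trans; [apply Cmod_triangle|]; rewrite Cmod_mult.
          pose proof (Cmod_ge_0 x) as Hx1.
          assert (⟦f11 (RtoC 0, w) - A⟧ * Cmod x <= K * (0 + Cmod k) * Cmod h)%R.
          { apply Rmult_le_compat; try apply Cmod_ge_0; assumption. }
          assert (K * (Cmod x + 0) ^ 2 <= K * s ^ 2)%R.
          { apply Rmult_le_compat_l; [exact HK|]; unfold s; nra. }
          assert (K * (0 + Cmod k) * Cmod h <= K * s ^ 2)%R.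
          { rewrite Rmult_assoc; apply Rmult_le_compat_l; [exact HK|]; unfold s; nra. }
          lra. }
      replace (h - 0) with h in B by ring; rewrite H0 in B.
      replace (f (h, w) / h - f1 (RtoC 0, w) - / 2 * A * h) with
        (((f (h, w) - f1 (RtoC 0, w) * h - / 2 * A * h * h)
        - (0 - f1 (RtoC 0, w) * 0 - / 2 * A * 0 * 0)) / h)
        by (field; exact Nh).
      rewrite Cmod_div by exact Nh.
      apply Cmod_gt_0 in Nh.
      apply (Rmult_le_reg_r (Cmod h)); [exact Nh|].
      unfold Rdiv; rewrite Rmult_assoc, Rinv_l, Rmult_1_r by lra; exact B. }
    assert (Hs : (3 * K * s ^ 2 <= eps * s)%R).
    { assert (H2 : (s <= 2 * (eps / (8 * (K + 1))))%R) by (unfold s; lra).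
      apply (Rmult_le_compat_l (4 * (K + 1))) in H2; [|lra].
      replace (4 * (K + 1) * (2 * (eps / (8 * (K + 1)))))%R with eps in H2 by (field; lra).
      assert (Hs0 : (0 <= s)%R) by (unfold s; lra).
      pose proof (Rmult_le_compat_r s _ _ Hs0 H2).
      pose proof (pow2_ge_0 s); nra. }
    fold s; eapply Rle_trans; [|exact Hs].
    assert (Ks : (0 <= K * s ^ 2)%R) by (apply Rmult_le_pos; [exact HK|apply pow2_ge_0]).
    destruct (Ceq_dec h 0) as [Eh|Nh].
    + rewrite Eh, Q0.
      replace (f1 (RtoC 0, w) - f1 (RtoC 0, w0) - (/ 2 * A * 0 + f12 (RtoC 0, w0) * k))
        with (f1 (RtoC 0, w) - f1 (RtoC 0, w0) - f12 (RtoC 0, w0) * k) by ring.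
      lra.
    + rewrite (Q1 h w Nh).
      replace (f (h, w) / h - f1 (RtoC 0, w0) - (/ 2 * A * h + f12 (RtoC 0, w0) * k))
        with ((f (h, w) / h - f1 (RtoC 0, w) - / 2 * A * h)
          + (f1 (RtoC 0, w) - f1 (RtoC 0, w0) - f12 (RtoC 0, w0) * k)) by ring.
      eapply Rle_trans; [apply Cmod_triangle|]; specialize (Hz Nh); lra.
  (* Away from z = 0 these are the partial derivatives given by the quotient rule. *)
  - set (a := (f1 (z0, w0) - f (z0, w0) / z0) / z0); set (b := f2 (z0, w0) / z0).
    exists a, b; intros eps He.
    pose proof (proj1 (Cmod_gt_0 _) N) as Hz.
    set (m := Cmod z0) in *.
    pose proof (Cmod_ge_0 a) as Ha; pose proof (Cmod_ge_0 b) as Hb.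
    set (B := (Cmod a + Cmod b + 1)%R); assert (HB : (0 < B)%R) by (unfold B; lra).
    destruct (P (z0, w0) (eps * m / 4)%R) as [d [Hd H]].
    { apply Rdiv_lt_0_compat; [apply Rmult_lt_0_compat|]; lra. }
    set (e := (eps * m / (4 * B))%R).
    assert (He0 : (0 < e)%R)
      by (apply Rdiv_lt_0_compat; apply Rmult_lt_0_compat; lra).
    (* m / 2 keeps |z0 + h| >= m / 2. The two error terms are each at most eps m s / 4, so their sum
       is at most eps s |z0 + h|. *)
    exists (Rmin d (Rmin (m / 2) e)); split; [repeat apply Rmin_pos; lra|].
    intros h k Hh Hk; simpl.
    pose proof (Rmin_l d (Rmin (m / 2) e)); pose proof (Rmin_r d (Rmin (m / 2) e)).
    pose proof (Rmin_l (m / 2) e); pose proof (Rmin_r (m / 2) e).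
    specialize (H h k ltac:(lra) ltac:(lra)); simpl in H.
    assert (Hm : (m / 2 <= ⟦z0 + h⟧)%R).
    { pose proof (Cmod_triangle (z0 + h) (- h)) as T; rewrite Cmod_opp in T.
      replace (z0 + h + - h) with z0 in T by ring; fold m in T; lra. }
    assert (Nh : z0 + h <> 0) by (apply Cmod_gt_0; lra).
    rewrite !Q1 by assumption.
    set (R0 := f (z0 + h, w0 + k) - f (z0, w0) - (f1 (z0, w0) * h + f2 (z0, w0) * k)) in *.
    replace (f (z0 + h, w0 + k) / (z0 + h) - f (z0, w0) / z0 - (a * h + b * k))
      with ((R0 + - (h * (a * h + b * k))) / (z0 + h))
      by (unfold R0, a, b; field; split; assumption).
    rewrite Cmod_div by exact Nh.
    pose proof (Cmod_ge_0 h) as Hh0; pose proof (Cmod_ge_0 k) as Hk0.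
    set (s := (Cmod h + Cmod k)%R) in *; assert (Hs : (0 <= s)%R) by (unfold s; lra).
    assert (Hq : (⟦h * (a * h + b * k)⟧ <= e * (B * s))%R).
    { rewrite Cmod_mult; apply Rmult_le_compat; try apply Cmod_ge_0; [lra|].
      eapply Rle_trans; [apply Cmod_triangle|]; rewrite !Cmod_mult; unfold B, s; nra. }
    replace (e * (B * s))%R with (eps * m / 4 * s)%R in Hq by (unfold e; field; lra).
    apply (Rmult_le_reg_r ⟦z0 + h⟧); [lra|].
    unfold Rdiv at 1; rewrite Rmult_assoc, Rinv_l, Rmult_1_r by lra.
    eapply Rle_trans; [apply Cmod_triangle|]; rewrite Cmod_opp.
    assert (0 <= eps * s)%R by (apply Rmult_le_pos; lra).
    assert (eps * s * (m / 2) <= eps * s * ⟦z0 + h⟧)%R by (apply Rmult_le_compat_l; lra).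
    lra.
Qed.

Theorem entire2_divide_snd (f : C * C -> C) :
  entire2 f -> (forall z, f (z, RtoC 0) = 0) ->
  exists q, entire2 q /\ forall z w, f (z, w) = w * q (z, w).
Proof.
  intros Hf H0.
  destruct (entire2_divide_fst (fun p => f (snd p, fst p)) (entire2_swap f Hf) H0)
    as [q [Hq E]].
  exists (fun p => q (snd p, fst p)); split; [apply entire2_swap, Hq|].
  intros z w; exact (E w z).
Qed.

(** * Sections on [Z_k] *)

(* [f_U = z^m f_V] on the overlap; [m = 0] gives the functions on [Z_k]. *)
Definition twisted_section (k m : nat) (f : chart_pair) : Prop :=
  entire2 (onU f) /\ entire2 (onV f) /\
  forall z u : C, z <> 0 -> onU f (z, u) = z ^ m * onV f (/ z, z ^ k * u).

Lemma twisted_section_0 (k : nat) (f : chart_pair) :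
  twisted_section k 0 f <-> global_function k f.
Proof.
  unfold twisted_section, global_function, glue.
  split; intros (HU & HV & H); split; [|split| |split]; try assumption;
    intros z u Nz; specialize (H z u Nz).
  - rewrite H; simpl; ring.
  - rewrite <- H; simpl; ring.
Qed.

(* In the monomial expansion [g] collects the terms [z^(k i + m + 1) u^i], the only ones
   that do not vanish along [xi = 0] in the chart [V]. *)
Lemma twisted_section_peel (k m : nat) (f : chart_pair) :
  twisted_section k (S m) f ->
  exists g f' : chart_pair, global_function k g /\ twisted_section k m f' /\
    (forall z u : C, onU f (z, u) = z ^ S m * onU g (z, u) + onU f' (z, u)) /\
    (forall xi v : C, onV f (xi, v) = onV g (xi, v) + xi * onV f' (xi, v)).
Proof.
  intros (HU & HV & H).
  assert (Hc : forall e : C * C -> C, entire2 e -> entire2 (fun p => onV f (RtoC 0, e p))).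
  { intros e He; apply (entire2_comp (fun w => onV f (RtoC 0, w))); [|exact He].
    apply entire_slice_r, HV. }
  set (g := ChartPair (fun p => onV f (RtoC 0, fst p ^ k * snd p)) (fun p => onV f (RtoC 0, snd p))).
  assert (HgU : entire2 (onU g)).
  { apply (Hc (fun p => fst p ^ k * snd p)), entire2_mult; [|apply entire2_snd].
    apply entire2_pow, entire2_fst. }
  assert (HgV : entire2 (onV g)) by apply Hc, entire2_snd.
  destruct (entire2_divide_fst (fun p => onV f p - onV g p)) as [q [Hq Eq]].
  - apply entire2_minus; assumption.
  - intros w; unfold g; simpl; ring.
  - exists g, (ChartPair (fun p => onU f p - fst p ^ S m * onU g p) q).
    split; [|split; [|split]].
    + split; [exact HgU|split; [exact HgV|reflexivity]].
    + split; [|split; [exact Hq|]].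
      * apply entire2_minus; [exact HU|]; apply entire2_mult; [|exact HgU].
        apply entire2_pow, entire2_fst.
      * intros z u Nz; cbn [onU onV fst].
        replace (onU g (z, u)) with (onV g (/ z, z ^ k * u)) by reflexivity.
        rewrite (H z u Nz).
        replace (z ^ S m * onV f (/ z, z ^ k * u) - z ^ S m * onV g (/ z, z ^ k * u))
          with (z ^ S m * (onV f (/ z, z ^ k * u) - onV g (/ z, z ^ k * u))) by ring.
        (* The degree drops here: z^(m+1) xi = z^m on the overlap. *)
        rewrite Eq, Cpow_S; field; exact Nz.
    + intros z u; cbn [onU onV fst]; ring.
    + intros xi v; cbn [onU onV fst]; rewrite <- Eq; ring.
Qed.

Lemma Cpow_split (z : C) (k : nat) : (2 <= k)%nat -> z ^ k = z ^ (k - 2) * z ^ 2.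
Proof. intros Hk; rewrite <- Cpow_add_r; f_equal; lia. Qed.

(* [onU sigma (z, 0) = - onV sigma (1/z, 0) / z^(k-2)] tends to [0] at infinity. *)
Lemma poisson_vanishes_on_zero_section (k : nat) (sigma : chart_pair) :
  (3 <= k)%nat -> poisson_structure k sigma ->
  (forall z : C, onU sigma (z, RtoC 0) = 0) /\ (forall xi : C, onV sigma (xi, RtoC 0) = 0).
Proof.
  intros Hk (HU & HV & H).
  assert (HVU : forall z : C, z <> 0 ->
    onV sigma (/ z, RtoC 0) = - z ^ (k - 2) * onU sigma (z, RtoC 0)).
  { intros z Nz; specialize (H z (RtoC 0) Nz); unfold glue in H.
    rewrite Cmult_0_r in H; rewrite H, (Cpow_split z k ltac:(lia)).
    field; exact Nz. }
  assert (HU0 : forall z : C, onU sigma (z, RtoC 0) = 0).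
  { apply (liouville_vanishing (fun z => onU sigma (z, RtoC 0))); [apply entire_slice_l, HU|].
    destruct (entire2_continuous _ (RtoC 0, RtoC 0) HV 1 ltac:(lra)) as [d [Hd Hc]]; simpl in Hc.
    set (M := (⟦onV sigma (RtoC 0, RtoC 0)⟧ + 1)%R).
    pose proof (Cmod_ge_0 (onV sigma (RtoC 0, RtoC 0))) as HM0.
    (* The three summands ensure |z| >= 1, |1/z| < d and |z| >= M / eps, in this order. *)
    intros eps He; exists (1 + 2 / d + M / eps)%R; intros z Hz.
    assert (0 < 2 / d)%R by (apply Rdiv_lt_0_compat; lra).
    assert (0 < M / eps)%R by (apply Rdiv_lt_0_compat; unfold M; lra).
    assert (Nz : z <> 0) by (apply Cmod_gt_0; lra).
    assert (Hinv : (⟦/ z⟧ < d)%R).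
    { rewrite Cmod_inv by exact Nz.
      apply (Rmult_lt_reg_r (Cmod z)); [lra|]; rewrite Rinv_l by lra.
      assert (d * (2 / d) <= d * Cmod z)%R by (apply Rmult_le_compat_l; lra).
      replace (d * (2 / d))%R with 2%R in * by (field; lra); lra. }
    specialize (Hc (/ z) (RtoC 0) Hinv ltac:(rewrite Cmod_0; exact Hd)).
    rewrite !Cplus_0_l in Hc.
    assert (Hb : (⟦onV sigma (/ z, RtoC 0)⟧ <= M)%R).
    { replace (onV sigma (/ z, RtoC 0)) with
        ((onV sigma (/ z, RtoC 0) - onV sigma (RtoC 0, RtoC 0)) + onV sigma (RtoC 0, RtoC 0)) by ring.
      eapply Rle_trans; [apply Cmod_triangle|]; unfold M; lra. }
    rewrite HVU, Cmod_mult, Cmod_opp, Cmod_pow in Hb by exact Nz.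
    set (x := ⟦onU sigma (z, RtoC 0)⟧) in *.
    assert (Hx : (0 <= x)%R) by apply Cmod_ge_0.
    (* This is where k >= 3 enters: the exponent is at least 1. *)
    assert (Hp : (Cmod z <= Cmod z ^ (k - 2))%R).
    { rewrite <- (pow_1 (Cmod z)) at 1; apply Rle_pow; [lra|lia]. }
    assert (Hxz : (Cmod z * x <= M)%R)
      by (eapply Rle_trans; [|exact Hb]; apply Rmult_le_compat_r; assumption).
    assert (Hxe : (M / eps * x <= M)%R)
      by (eapply Rle_trans; [|exact Hxz]; apply Rmult_le_compat_r; lra).
    apply (Rmult_le_reg_l (M / eps)); [assumption|].
    replace (M / eps * eps)%R with M by (field; lra); exact Hxe. }
  split; [exact HU0|].
  assert (HV0 : forall xi : C, xi <> 0 -> onV sigma (xi, RtoC 0) = 0).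
  { intros xi Nxi.
    assert (Ni : / xi <> 0).
    { intros E; apply Nxi; replace xi with (xi * xi * / xi) by (field; exact Nxi).
      rewrite E; ring. }
    replace xi with (/ / xi) by (field; assumption).
    rewrite (HVU (/ xi) Ni), HU0; ring. }
  intros xi; destruct (Ceq_dec xi 0) as [->|N]; [|apply HV0, N].
  apply (entire_cder_zero_off_origin (fun xi => onV sigma (xi, RtoC 0)));
    [apply entire_slice_l, HV|exact HV0].
Qed.

Lemma poisson_divide_fibre (k : nat) (sigma : chart_pair) :
  (3 <= k)%nat -> poisson_structure k sigma ->
  exists tau : chart_pair, twisted_section k 2 tau /\
    (forall z u : C, onU sigma (z, u) = u * onU tau (z, u)) /\
    (forall xi v : C, onV sigma (xi, v) = - (v * onV tau (xi, v))).
Proof.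
  intros Hk Hs.
  destruct (poisson_vanishes_on_zero_section k sigma Hk Hs) as [U0 V0].
  destruct Hs as (HU & HV & H).
  destruct (entire2_divide_snd _ HU U0) as [qU [HqU EU]].
  destruct (entire2_divide_snd _ HV V0) as [qV [HqV EV]].
  exists (ChartPair qU (fun p => - qV p)); split; [|split].
  - split; [exact HqU|split; [apply entire2_opp, HqV|]].
    intros z u Nz; cbn [onU onV].
    (* The gluing relation gives the identity only multiplied by u. For fixed z its defect [D] is
       entire in u and vanishes for u <> 0, hence also at u = 0. *)
    set (D := fun u => qU (z, u) + z ^ 2 * qV (/ z, z ^ k * u)).
    assert (HD : entire D).
    { unfold entire, D; apply entire2_plus; [apply (entire_slice_r qU z), HqU|].
      apply entire2_mult; [apply entire2_const|].
      apply (entire2_comp (fun w => qV (/ z, w))); [apply entire_slice_r, HqV|].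
      apply entire2_mult; [apply entire2_const|apply entire2_fst]. }
    assert (D0 : forall u : C, u <> 0 -> D u = 0).
    { intros x Nx; unfold D; specialize (H z x Nz); unfold glue in H.
      rewrite EU, EV, (Cpow_split z k ltac:(lia)) in H.
      rewrite (Cpow_split z k ltac:(lia)).
      set (A := qV (/ z, z ^ (k - 2) * z ^ 2 * x)) in *.
      pose proof (Cpow_nz z (k - 2) Nz) as Np.
      set (P := z ^ (k - 2)) in *.
      replace (z ^ 2 * A) with ((P * z ^ 2 * x * A) / (P * x)) by (field; split; assumption).
      rewrite H; field; repeat split; assumption. }
    enough (E : D u = 0).
    { unfold D in E; replace (qU (z, u)) with (qU (z, u) + z ^ 2 * qV (/ z, z ^ k * u) - z ^ 2 * qV (/ z, z ^ k * u)) by ring.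
      rewrite E; ring. }
    destruct (Ceq_dec u 0) as [->|Nu]; [|apply D0, Nu].
    apply entire_cder_zero_off_origin; assumption.
  - exact EU.
  - intros xi v; rewrite EV; cbn [onV]; ring.
Qed.

(** * The module of Poisson structures and its generators *)

Lemma chart_pair_ext (s t : chart_pair) :
  (forall z u : C, onU s (z, u) = onU t (z, u)) ->
  (forall xi v : C, onV s (xi, v) = onV t (xi, v)) -> s = t.
Proof.
  destruct s, t; simpl; intros HU HV; f_equal; apply functional_extensionality;
    intros [x y]; [apply HU|apply HV].
Qed.

Lemma poisson_submodule (k : nat) : is_submodule k (poisson_structure k).
Proof.
  split.
  - split; [exact (entire2_const 0)|split; [exact (entire2_const 0)|]].
    intros z u _; simpl; ring.
  - intros s t (HsU & HsV & Hs) (HtU & HtV & Ht).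
    split; [apply entire2_plus; assumption|split; [apply entire2_plus; assumption|]].
    intros z u Nz; cbn [onU onV cadd cmul]; rewrite Hs, Ht by exact Nz; ring.
  - intros f s (HfU & HfV & Hf) (HsU & HsV & Hs).
    split; [apply entire2_mult; assumption|split; [apply entire2_mult; assumption|]].
    intros z u Nz; cbn [onU onV cadd cmul]; rewrite Hs, Hf by exact Nz; ring.
Qed.

Fixpoint combination (coeffs gens : list chart_pair) : chart_pair :=
  match coeffs, gens with
  | f :: fs, e :: es => cadd (cmul f e) (combination fs es)
  | _, _ => czero
  end.

Lemma combination_submodule (k : nat) (M : chart_pair -> Prop) (fs es : list chart_pair) :
  is_submodule k M -> List.Forall (global_function k) fs -> List.Forall M es -> M (combination fs es).
Proof.
  intros HM Hfs; revert es; induction Hfs as [|f fs Hf Hfs IH]; intros es Hes.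
  - apply (submodule_zero _ _ HM).
  - destruct Hes as [|e es He Hes]; simpl; [apply (submodule_zero _ _ HM)|].
    apply (submodule_add _ _ HM); [apply (submodule_mul _ _ HM); assumption|apply IH, Hes].
Qed.

Lemma poisson_of_combination (k : nat) (gens fs : list chart_pair) (sigma : chart_pair) :
  List.Forall (poisson_structure k) gens -> List.Forall (global_function k) fs ->
  sigma = combination fs gens -> poisson_structure k sigma.
Proof.
  intros Hg Hfs ->; apply (combination_submodule k); auto using poisson_submodule.
Qed.

(** Explicit combinations lie in every submodule containing the generators; conversely, the Poisson
    structures are one of the submodules over which [span] quantifies. *)
Lemma poisson_generated_by (k : nat) (gens : list chart_pair) :
  List.Forall (poisson_structure k) gens ->
  (forall sigma, poisson_structure k sigma ->
    exists fs, List.Forall (global_function k) fs /\ sigma = combination fs gens) ->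
  generated_by k gens (poisson_structure k).
Proof.
  intros Hg H sigma; split.
  - intros Hs M HM HMg; destruct (H sigma Hs) as (fs & Hfs & ->).
    apply (combination_submodule k); [exact HM|exact Hfs|apply Forall_forall, HMg].
  - intros Hs; apply Hs; [apply poisson_submodule|apply Forall_forall, Hg].
Qed.

(** Stating m + k = 2 rather than m = 2 - k rules out truncated subtraction. The sign of the
    Jacobian is absorbed into the V-part. *)
Lemma poisson_twisted_section (k m : nat) (sigma : chart_pair) :
  (m + k = 2)%nat -> poisson_structure k sigma ->
  twisted_section k m (ChartPair (onU sigma) (fun p => - onV sigma p)).
Proof.
  intros Hm (HU & HV & H); split; [exact HU|split; [apply entire2_opp, HV|]].
  intros z u Nz; cbn [onU onV]; specialize (H z u Nz); unfold glue in H; rewrite H.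
  rewrite <- Hm, Cpow_add_r; field; split; apply Cpow_nz, Nz.
Qed.

Lemma poisson_structure_of_coords (k : nat) (eU eV : C -> C -> C) :
  entire2 (fun p => eU (fst p) (snd p)) -> entire2 (fun p => eV (fst p) (snd p)) ->
  (forall z u : C, z <> 0 -> eV (/ z) (z ^ k * u) = - (z ^ k / z ^ 2) * eU z u) ->
  poisson_structure k (ChartPair (fun '(z, u) => eU z u) (fun '(xi, v) => eV xi v)).
Proof.
  intros HU HV H; split; [|split; [|exact H]].
  - apply (entire2_ext (fun p => eU (fst p) (snd p))); [reflexivity|exact HU].
  - apply (entire2_ext (fun p => eV (fst p) (snd p))); [reflexivity|exact HV].
Qed.

Lemma poisson_decomposition_1 (sigma : chart_pair) : poisson_structure 1 sigma ->
  exists f g : chart_pair, global_function 1 f /\ global_function 1 g /\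
    (forall z u : C, onU sigma (z, u) = onU f (z, u) + z * onU g (z, u)) /\
    (forall xi v : C, onV sigma (xi, v) = - xi * onV f (xi, v) - onV g (xi, v)).
Proof.
  intros Hs.
  destruct (twisted_section_peel 1 0 _ (poisson_twisted_section 1 1 sigma eq_refl Hs))
    as (g & f & Hg & Hf & EU & EV).
  exists f, g; split; [apply (proj1 (twisted_section_0 _ _)), Hf|split; [exact Hg|split]].
  - intros z u; specialize (EU z u); cbn [onU] in EU; rewrite EU; simpl; ring.
  - intros xi v; specialize (EV xi v); cbn [onV] in EV.
    replace (onV sigma (xi, v)) with (- - onV sigma (xi, v)) by ring; rewrite EV; ring.
Qed.

Lemma poisson_decomposition_2 (sigma : chart_pair) : poisson_structure 2 sigma ->
  exists f : chart_pair, global_function 2 f /\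
    (forall z u : C, onU sigma (z, u) = onU f (z, u)) /\
    (forall xi v : C, onV sigma (xi, v) = - onV f (xi, v)).
Proof.
  intros Hs; exists (ChartPair (onU sigma) (fun p => - onV sigma p)).
  split; [apply (proj1 (twisted_section_0 _ _)), poisson_twisted_section; [reflexivity|exact Hs]|].
  split; intros; cbn [onU onV]; ring.
Qed.

(** The highest power is peeled first: h leaves with z^2, g with z, and f remains. On V each peeling
    puts a factor xi before the remainder, whence the coefficients 1, xi, xi^2 of h, g, f. *)
Lemma poisson_decomposition_ge_3 (k : nat) (sigma : chart_pair) :
  (3 <= k)%nat -> poisson_structure k sigma ->
  exists f g h : chart_pair,
    global_function k f /\ global_function k g /\ global_function k h /\
    (forall z u : C, onU sigma (z, u) =
      u * onU f (z, u) + z * u * onU g (z, u) + z ^ 2 * u * onU h (z, u)) /\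
    (forall xi v : C, onV sigma (xi, v) =
      - (xi ^ 2 * v * onV f (xi, v)) - xi * v * onV g (xi, v) - v * onV h (xi, v)).
Proof.
  intros Hk Hs.
  destruct (poisson_divide_fibre k sigma Hk Hs) as (tau & Ht & TU & TV).
  destruct (twisted_section_peel k 1 tau Ht) as (h & tau' & Hh & Ht' & HU & HV).
  destruct (twisted_section_peel k 0 tau' Ht') as (g & f & Hg & Hf & GU & GV).
  exists f, g, h; split; [apply (proj1 (twisted_section_0 _ _)), Hf|].
  split; [exact Hg|split; [exact Hh|split]].
  - intros z u; rewrite TU, HU, GU; simpl; ring.
  - intros xi v; rewrite TV, HV, GV; simpl; ring.
Qed.

Theorem lemma2p8 (k : nat) (hk : (1 <= k)%nat) :
  (k = 1%nat ->
    (forall sigma : chart_pair,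
      poisson_structure k sigma <->
      exists f g : chart_pair,
        global_function k f /\ global_function k g /\
        (forall z u : C,
          onU sigma (z, u) = onU f (z, u) + z * onU g (z, u)) /\
        (forall xi v : C,
          onV sigma (xi, v) = - xi * onV f (xi, v) - onV g (xi, v))) /\
    generated_by k
      (ChartPair (fun '(z, u) => 1) (fun '(xi, v) => - xi) ::
        ChartPair (fun '(z, u) => z) (fun '(xi, v) => - (1)) :: nil)
      (poisson_structure k)) /\
  (k = 2%nat ->
    (forall sigma : chart_pair,
      poisson_structure k sigma <->
      exists f : chart_pair,
        global_function k f /\
        (forall z u : C, onU sigma (z, u) = onU f (z, u)) /\
        (forall xi v : C, onV sigma (xi, v) = - onV f (xi, v))) /\
    generated_by k
      (ChartPair (fun '(z, u) => 1) (fun '(xi, v) => - (1)) :: nil)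
      (poisson_structure k)) /\
  ((3 <= k)%nat ->
    (forall sigma : chart_pair,
      poisson_structure k sigma <->
      exists f g h : chart_pair,
        global_function k f /\ global_function k g /\ global_function k h /\
        (forall z u : C,
          onU sigma (z, u) =
            u * onU f (z, u) + z * u * onU g (z, u) + z ^ 2 * u * onU h (z, u)) /\
        (forall xi v : C,
          onV sigma (xi, v) =
            - (xi ^ 2 * v * onV f (xi, v)) - xi * v * onV g (xi, v)
            - v * onV h (xi, v))) /\
    generated_by k
      (ChartPair (fun '(z, u) => u) (fun '(xi, v) => - (xi ^ 2 * v)) ::
        ChartPair (fun '(z, u) => z * u) (fun '(xi, v) => - (xi * v)) ::
        ChartPair (fun '(z, u) => z ^ 2 * u) (fun '(xi, v) => - v) :: nil)
      (poisson_structure k)).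
Proof.
  split; [|split].
  - intros ->.
    set (gens := _ :: _ :: nil).
    assert (Hg : List.Forall (poisson_structure 1) gens).
    { repeat apply List.Forall_cons; [| |apply List.Forall_nil].
      - apply (poisson_structure_of_coords 1 (fun _ _ => RtoC 1) (fun xi _ => - xi)).
        + exact (entire2_const 1).
        + exact (entire2_opp _ entire2_fst).
        + intros z u Nz; simpl; field; exact Nz.
      - apply (poisson_structure_of_coords 1 (fun z _ => z) (fun _ _ => - (1))).
        + exact entire2_fst.
        + exact (entire2_const (- (1))).
        + intros z u Nz; simpl; field; exact Nz. }
    (* The coordinate form is a combination of the generators; this one identity serves the
       description of sigma and the generation claim alike. *)
    assert (Hc : forall sigma f g : chart_pair,
      (forall z u : C, onU sigma (z, u) = onU f (z, u) + z * onU g (z, u)) ->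
      (forall xi v : C, onV sigma (xi, v) = - xi * onV f (xi, v) - onV g (xi, v)) ->
      sigma = combination (f :: g :: nil) gens).
    { intros sigma f g EU EV; apply chart_pair_ext; intros x y;
        [rewrite EU|rewrite EV]; simpl; ring. }
    split.
    + intros sigma; split; [apply poisson_decomposition_1|].
      intros (f & g & Hf & Hg' & EU & EV).
      apply (poisson_of_combination 1 gens (f :: g :: nil)); auto.
    + apply poisson_generated_by; [exact Hg|]; intros sigma Hs.
      destruct (poisson_decomposition_1 sigma Hs) as (f & g & Hf & Hg' & EU & EV).
      exists (f :: g :: nil); auto.
  - intros ->.
    set (gens := _ :: nil).
    assert (Hg : List.Forall (poisson_structure 2) gens).
    { apply List.Forall_cons; [|apply List.Forall_nil].
      apply (poisson_structure_of_coords 2 (fun _ _ => RtoC 1) (fun _ _ => - (1))).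
      - exact (entire2_const 1).
      - exact (entire2_const (- (1))).
      - intros z u Nz; simpl; field; exact Nz. }
    assert (Hc : forall sigma f : chart_pair,
      (forall z u : C, onU sigma (z, u) = onU f (z, u)) ->
      (forall xi v : C, onV sigma (xi, v) = - onV f (xi, v)) ->
      sigma = combination (f :: nil) gens).
    { intros sigma f EU EV; apply chart_pair_ext; intros x y;
        [rewrite EU|rewrite EV]; simpl; ring. }
    split.
    + intros sigma; split; [apply poisson_decomposition_2|].
      intros (f & Hf & EU & EV).
      apply (poisson_of_combination 2 gens (f :: nil)); auto.
    + apply poisson_generated_by; [exact Hg|]; intros sigma Hs.
      destruct (poisson_decomposition_2 sigma Hs) as (f & Hf & EU & EV).
      exists (f :: nil); auto.
  - intros Hk.
    set (gens := _ :: _ :: _ :: nil).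
    assert (Hg : List.Forall (poisson_structure k) gens).
    { repeat apply List.Forall_cons; [| | |apply List.Forall_nil].
      - apply (poisson_structure_of_coords k (fun _ u => u) (fun xi v => - (xi ^ 2 * v))).
        + exact entire2_snd.
        + exact (entire2_opp _ (entire2_mult _ _ (entire2_pow _ 2 entire2_fst) entire2_snd)).
        + intros z u Nz; field; exact Nz.
      - apply (poisson_structure_of_coords k (fun z u => z * u) (fun xi v => - (xi * v))).
        + exact (entire2_mult _ _ entire2_fst entire2_snd).
        + exact (entire2_opp _ (entire2_mult _ _ entire2_fst entire2_snd)).
        + intros z u Nz; field; exact Nz.
      - apply (poisson_structure_of_coords k (fun z u => z ^ 2 * u) (fun _ v => - v)).
        + exact (entire2_mult _ _ (entire2_pow _ 2 entire2_fst) entire2_snd).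
        + exact (entire2_opp _ entire2_snd).
        + intros z u Nz; field; exact Nz. }
    assert (Hc : forall sigma f g h : chart_pair,
      (forall z u : C, onU sigma (z, u) =
        u * onU f (z, u) + z * u * onU g (z, u) + z ^ 2 * u * onU h (z, u)) ->
      (forall xi v : C, onV sigma (xi, v) =
        - (xi ^ 2 * v * onV f (xi, v)) - xi * v * onV g (xi, v) - v * onV h (xi, v)) ->
      sigma = combination (f :: g :: h :: nil) gens).
    { intros sigma f g h EU EV; apply chart_pair_ext; intros x y;
        [rewrite EU|rewrite EV]; simpl; ring. }
    split.
    + intros sigma; split; [apply poisson_decomposition_ge_3, Hk|].
      intros (f & g & h & Hf & Hg' & Hh & EU & EV).
      apply (poisson_of_combination k gens (f :: g :: h :: nil)); auto.
    + apply poisson_generated_by; [exact Hg|]; intros sigma Hs.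
      destruct (poisson_decomposition_ge_3 k sigma Hk Hs)
        as (f & g & h & Hf & Hg' & Hh & EU & EV).
      exists (f :: g :: h :: nil); auto.
Qed.
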